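(* Any integer $m>1$ with $m\neq 10$ can be written as $x^2+y^2+z^2+w^2$ with $x,y,z,w\in\mathbb{Z}$ and $x+2y+3z\in\{4^a: a\in\mathbb{Z}^+\}$.
   Context: $\mathbb{Z}^+=\{1,2,3,\ldots\}$. *)

(* Defs.v *)
From mathcomp Require Import all_boot all_order all_algebra.

Set Implicit Arguments.
Unset Strict Implicit.
Unset Printing Implicit Defensive.

(* Main.v *)
Require Import Defs.
From mathcomp Require Import all_boot all_order all_algebra.
From mathcomp Require Import all_fingroup all_solvable all_field.
From mathcomp Require Import ring lra zify.
From mathcomp Require Import realalg boolp.

(** Why the theorem holds.

    Suppose m = x^2 + y^2 + z^2 + w^2 and n = x + 2y + 3z. The vector
    (1, 2, 3, 0) has norm 14 and is completed to an orthogonal frame of vectors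
    of norm 14 by (-2, 1, 0, 3), (-3, 0, 1, -2) and (0, -3, 2, 1) (quaternion
    multiplication by 1 + 2i + 3j). If b, c, d are the inner products of
    (x, y, z, w) with these three, then 14 m = n^2 + b^2 + c^2 + d^2. Conversely,
    from such a decomposition of 14 m one gets (x, y, z, w) as a combination of
    the frame divided by 14, and it is integral after a suitable signed
    permutation of (b, c, d) [four_squares_of_three]. So the problem is to find
    a > 0 such that 14 m - 16^a is a sum of three squares. By the three-square
    theorem this is a matter of residues modulo 8: a = 1 or a = 2 works unless
    16 divides m, and then one passes to m / 16 [fourteen_mul_sub_pow16].

    The three-square theorem is proved for N = 1, 2 mod 4 and N = 3 mod 8. If q
    is a positive integer prime to N with -q a square modulo N and -N a square
    modulo q, then N and the binary form of determinant N attached to q glue to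
    a positive ternary integral form of determinant 1 which represents N
    [three_squares_of_mutual_residues]; by Hermite reduction this form is a sum
    of three squares of linear forms [unimodular_ternary_is_gram].

    The number q, or q / 2 when N = 3 mod 8, is sought as a product of primes p
    with chi p = 1, where chi is the quadratic character n |-> (-N / n): this
    makes -N a square modulo q, and -q is a square modulo N as soon as q lies in
    a suitable class modulo squares, on which chi takes the value 1. Let W be
    the group of classes of s^2 m with m such a product. If a class c with chi c
    = 1 were outside W, some quadratic character f would be trivial on W with f
    c = -1, and then no prime p could have f p = -1 and (f chi) p = -1 at once.
    But two nontrivial quadratic characters f, g always have a common prime with
    value -1 [prime_both_minus_one]: otherwise the Dirichlet convolution f * g
    would be nonnegative, and at least 1 on squares prime to the modulus, so
    that the sum of (f * g)(n) / sqrt n would dominate a harmonic series,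
    whereas the hyperbola method shows that this sum is bounded. Quadratic
    reciprocity, proved with Gauss sums in finite fields, is what makes chi
    periodic [jacobi_symbol]. *)

Import Order.TTheory GRing.Theory Num.Theory.
Local Open Scope ring_scope.

(** * From 14 m = n^2 + b^2 + c^2 + d^2 to four squares with x + 2y + 3z = n *)

Definition permute3 (p : nat) (b c d : int) : int * int * int :=
  match p with
  | 0%N => (b, c, d) | 1%N => (b, d, c) | 2%N => (c, b, d)
  | 3%N => (c, d, b) | 4%N => (d, b, c) | _ => (d, c, b)
  end.

(** The four conditions say that the combination of the orthogonal frame
    (1, 2, 3, 0), (-2, 1, 0, 3), (-3, 0, 1, -2), (0, -3, 2, 1) with coefficients
    n, b, c, d has all its coordinates divisible by 14. *)
Definition div14 (n : int) (t : int * int * int) : bool :=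
  let: (b, c, d) := t in
  [&& (14 %| n - 2 * b - 3 * c)%Z, (14 %| 2 * n + b - 3 * d)%Z,
      (14 %| 3 * n + c + 2 * d)%Z & (14 %| 3 * b - 2 * c + d)%Z].

Definition signs : seq int := [:: 1; -1].

(** Representatives of the classes modulo 14 up to sign: the signs are absorbed
    by the signed permutations. *)
Definition residues : seq int := [:: 0; 1; 2; 3; 4; 5; 6; 7].

(** In quaternion terms: a quaternion whose norm is divisible by 14 has a left
    divisor of norm 14, and the integral quaternions of norm 14 are the signed
    permutations of (0, 1, 2, 3). The finite form of this fact is checked by
    computation. *)
Lemma div14_residues :
  all (fun n => all (fun b => all (fun c => all (fun d =>
    (14 %| n ^+ 2 + b ^+ 2 + c ^+ 2 + d ^+ 2)%Z ==>
    has (fun p => has (fun s => has (fun t => has (fun u =>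
      div14 n (permute3 p (s * b) (t * c) (u * d)))
      signs) signs) signs) (iota 0 6))
    residues) residues) residues) residues.
Proof. by vm_compute. Qed.

Lemma residue14 (n : int) :
  exists r s k : int, [/\ r \in residues, s \in signs & n = s * r + 14 * k].
Proof.
have : exists r k : int, [/\ 0 <= r, r < 14 & n = r + 14 * k].
  exists (n %% 14)%Z, (n %/ 14)%Z; split; [exact: modz_ge0 | exact: ltz_pmod |].
  by rewrite {1}(divz_eq n 14); ring.
case=> r [k [r0 r14 ->]].
have [r7|r7] := leP r 7.
  exists r, 1, k; split; [|by [] |ring].
  have : (r = 0 \/ r = 1 \/ r = 2 \/ r = 3 \/ r = 4 \/ r = 5 \/ r = 6 \/ r = 7) by lia.
  by do ?[case=> [->//|]] => ->.
exists (14 - r), (-1), (k + 1); split; [|by [] |ring].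
have : (r = 8 \/ r = 9 \/ r = 10 \/ r = 11 \/ r = 12 \/ r = 13) by lia.
by do ?[case=> [->//|]] => ->.
Qed.

Lemma signs_sq s : s \in signs -> s * s = 1.
Proof. by rewrite !inE => /orP[] /eqP->. Qed.

Lemma sqr_lift (s x k : int) : s * s = 1 ->
  (s * x + 14 * k) ^+ 2 = x ^+ 2 + (2 * s * x * k + 14 * k ^+ 2) * 14.
Proof.
move=> ss; have -> : x ^+ 2 = s * s * x ^+ 2 by rewrite ss mul1r.
by ring.
Qed.

Lemma dvdz14_lift (s x k y : int) : s * s = 1 -> y = s * x + 14 * k -> (14 %| x)%Z -> (14 %| y)%Z.
Proof. by move=> ? -> /dvdzP[q ->]; apply/dvdzP; exists (s * q + k); ring. Qed.

Lemma div14_exists (n b c d : int) :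
  (14 %| n ^+ 2 + b ^+ 2 + c ^+ 2 + d ^+ 2)%Z ->
  exists b' c' d' : int,
    b' ^+ 2 + c' ^+ 2 + d' ^+ 2 = b ^+ 2 + c ^+ 2 + d ^+ 2 /\ div14 n (b', c', d').
Proof.
have [n0 [sn [kn [n0r /signs_sq snn ->]]]] := residue14 n.
have [b0 [sb [kb [b0r /signs_sq sbb ->]]]] := residue14 b.
have [c0 [sc [kc [c0r /signs_sq scc ->]]]] := residue14 c.
have [d0 [sd [kd [d0r /signs_sq sdd ->]]]] := residue14 d => dv.
have /hasP[p _ /hasP[s /signs_sq ss /hasP[t /signs_sq tt /hasP[u /signs_sq uu dv']]]] :
  has (fun p => has (fun s => has (fun t => has (fun u =>
      div14 n0 (permute3 p (s * b0) (t * c0) (u * d0)))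
      signs) signs) signs) (iota 0 6).
  have /allP/(_ _ n0r)/allP/(_ _ b0r)/allP/(_ _ c0r)/allP/(_ _ d0r)/implyP := div14_residues.
  apply; move/dvdzP: dv => [q qE]; apply/dvdzP.
  exists (q - ((2 * sn * n0 * kn + 14 * kn ^+ 2) + (2 * sb * b0 * kb + 14 * kb ^+ 2)
     + (2 * sc * c0 * kc + 14 * kc ^+ 2) + (2 * sd * d0 * kd + 14 * kd ^+ 2))).
  rewrite mulrBl -qE !sqr_lift //; ring.
pose P := permute3 p (s * b0) (t * c0) (u * d0).
pose Q := permute3 p (sn * s * sb * kb) (sn * t * sc * kc) (sn * u * sd * kd).
(* The permutation found for the residues, with its signs multiplied by those of
   n and of b, c, d: P is the part that is seen modulo 14. *)
exists (sn * P.1.1 + 14 * Q.1.1), (sn * P.1.2 + 14 * Q.1.2), (sn * P.2 + 14 * Q.2).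
split.
  have sq (v e x0 k0 : int) : v * v = 1 -> e * e = 1 ->
      (sn * (v * x0) + 14 * (sn * v * e * k0)) ^+ 2 = (e * x0 + 14 * k0) ^+ 2.
    move=> vv ee; have -> : sn * (v * x0) + 14 * (sn * v * e * k0) =
       sn * v * (x0 + 14 * (e * k0)) by ring.
    have -> : e * x0 + 14 * k0 = e * x0 + 14 * (e * e * k0) by rewrite ee mul1r.
    have -> : (sn * v * (x0 + 14 * (e * k0))) ^+ 2 =
       (sn * sn) * (v * v) * (x0 + 14 * (e * k0)) ^+ 2 by ring.
    have -> : (e * x0 + 14 * (e * e * k0)) ^+ 2 = (e * e) * (x0 + 14 * (e * k0)) ^+ 2 by ring.
    by rewrite snn vv ee !mul1r.
  by rewrite /P /Q; case: p {P Q dv'} => [|[|[|[|[|?]]]]] /=; rewrite !sq //; ring.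
rewrite -/P in dv'; move: P Q dv' => [[b' c'] d'] [[x y] z] /and4P[h1 h2 h3 h4] /=.
apply/and4P; split.
- by apply: (dvdz14_lift _ _ (kn - 2 * x - 3 * y) _ snn _ h1); ring.
- by apply: (dvdz14_lift _ _ (2 * kn + x - 3 * z) _ snn _ h2); ring.
- by apply: (dvdz14_lift _ _ (3 * kn + y + 2 * z) _ snn _ h3); ring.
- by apply: (dvdz14_lift _ _ (3 * x - 2 * y + z) _ snn _ h4); ring.
Qed.

(** Division by 14 keeps the sum of squares under control because the frame is
    orthogonal with vectors of norm 14. *)
Lemma four_squares_of_three (m n b c d : int) :
  14 * m = n ^+ 2 + b ^+ 2 + c ^+ 2 + d ^+ 2 ->
  exists x y z w : int, m = x ^+ 2 + y ^+ 2 + z ^+ 2 + w ^+ 2 /\ x + 2 * y + 3 * z = n.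
Proof.
move=> mE; have [|b' [c' [d' [eq /and4P[]]]]] := @div14_exists n b c d.
  by rewrite -mE dvdz_mulr.
move=> /dvdzP[x xE] /dvdzP[y yE] /dvdzP[z zE] /dvdzP[w wE].
exists x, y, z, w; split; last by lia.
have : 196 * m = 196 * (x ^+ 2 + y ^+ 2 + z ^+ 2 + w ^+ 2).
  have -> : 196 * (x ^+ 2 + y ^+ 2 + z ^+ 2 + w ^+ 2) =
    (x * 14) ^+ 2 + (y * 14) ^+ 2 + (z * 14) ^+ 2 + (w * 14) ^+ 2 by ring.
  rewrite -xE -yE -zE -wE.
  have -> : 196 * m = 14 * (14 * m) by ring.
  by rewrite mE -!addrA (addrA (b ^+ 2)) -eq; ring.
by move/(mulfI _); apply.
Qed.

(** * Positive ternary forms of determinant 1 *)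

Definition dot3 (u v : int * int * int) : int :=
  u.1.1 * v.1.1 + u.1.2 * v.1.2 + u.2 * v.2.

(** The sextuple stands for the form
    a x^2 + b y^2 + c z^2 + 2 r y z + 2 s x z + 2 t x y. It is a Gram matrix of
    integral vectors exactly when the form is a sum of three squares of integral
    linear forms, a property that is invariant under the unimodular changes of
    basis below. *)
Definition is_gram (a b c r s t : int) : Prop :=
  exists u v w : int * int * int,
    [/\ a = dot3 u u, b = dot3 v v & c = dot3 w w] /\
    [/\ r = dot3 v w, s = dot3 u w & t = dot3 u v].

Definition lin2 (p : int) (u : int * int * int) (q : int) (v : int * int * int) :=
  (p * u.1.1 + q * v.1.1, p * u.1.2 + q * v.1.2, p * u.2 + q * v.2).

Lemma is_gram_swap a b c r s t : is_gram b a c s r t -> is_gram a b c r s t.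
Proof.
move=> [u [v [w [[-> -> ->] [-> -> ->]]]]]; exists v, u, w.
by do 2![split=> //]; rewrite /dot3; ring.
Qed.

Lemma is_gram_shift12 k a b c r s t :
  is_gram a (b + 2 * k * t + k ^+ 2 * a) c (r + k * s) s (t + k * a) ->
  is_gram a b c r s t.
Proof.
move=> [u [v [w [[aE bE cE] [rE sE tE]]]]]; exists u, (lin2 1 v (- k) u), w.
have t' : t = dot3 u v - k * dot3 u u by rewrite -tE -aE; ring.
have r' : r = dot3 v w - k * dot3 u w by rewrite -rE -sE; ring.
have b' : b = dot3 v v - 2 * k * t - k ^+ 2 * dot3 u u by rewrite -bE -aE; ring.
rewrite b' r' t' aE cE sE; clear.
by do 2![split]; rewrite /dot3 /=; ring.
Qed.

Lemma is_gram_shift3 k l a b c r s t :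
  is_gram a b (c + 2 * k * s + 2 * l * r + k ^+ 2 * a + l ^+ 2 * b + 2 * k * l * t)
    (r + k * t + l * b) (s + k * a + l * t) t ->
  is_gram a b c r s t.
Proof.
move=> [u [v [w [[aE bE cE] [rE sE tE]]]]].
exists u, v, (lin2 1 (lin2 1 w (- k) u) (- l) v).
have r' : r = dot3 v w - k * dot3 u v - l * dot3 v v by rewrite -rE -bE -tE; ring.
have s' : s = dot3 u w - k * dot3 u u - l * dot3 u v by rewrite -sE -aE -tE; ring.
have c' : c = dot3 w w - (2 * k * s + 2 * l * r + k ^+ 2 * dot3 u u + l ^+ 2 * dot3 v v
   + 2 * k * l * dot3 u v) by rewrite -cE -aE -bE -tE; ring.
rewrite c' r' s' aE bE tE; clear.
by do 2![split]; rewrite /dot3 /=; ring.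
Qed.

Lemma is_gram_mix23 p q p' q' a b c r s t : p * q' - q * p' = 1 ->
  is_gram a (p ^+ 2 * b + 2 * p * q * r + q ^+ 2 * c)
            (p' ^+ 2 * b + 2 * p' * q' * r + q' ^+ 2 * c)
            (p * p' * b + (p * q' + q * p') * r + q * q' * c)
            (p' * t + q' * s) (p * t + q * s) ->
  is_gram a b c r s t.
Proof.
move=> d1 [u [v [w [[aE bE cE] [rE sE tE]]]]].
exists u, (lin2 q' v (- q) w), (lin2 p w (- p') v).
have s' : s = p * dot3 u w - p' * dot3 u v.
  by rewrite -sE -tE -[LHS]mul1r -d1; ring.
have t' : t = q' * dot3 u v - q * dot3 u w.
  by rewrite -sE -tE -[LHS]mul1r -d1; ring.
have d2 : (p * q' - q * p') ^+ 2 = 1 by rewrite d1 expr1n.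
have b' : b = q' ^+ 2 * dot3 v v - 2 * q * q' * dot3 v w + q ^+ 2 * dot3 w w.
  by transitivity ((p * q' - q * p') ^+ 2 * b); [rewrite d2 mul1r | rewrite -bE -cE -rE; ring].
have c' : c = p' ^+ 2 * dot3 v v - 2 * p * p' * dot3 v w + p ^+ 2 * dot3 w w.
  by transitivity ((p * q' - q * p') ^+ 2 * c); [rewrite d2 mul1r | rewrite -bE -cE -rE; ring].
have r' : r = - (p' * q') * dot3 v v + (p * q' + q * p') * dot3 v w - p * q * dot3 w w.
  by transitivity ((p * q' - q * p') ^+ 2 * r); [rewrite d2 mul1r | rewrite -bE -cE -rE; ring].
rewrite b' c' r' s' t' aE; clear.
by do 2![split]; rewrite /dot3 /=; ring.
Qed.

Lemma shift_small (a t : int) : 0 < a -> exists k : int, - a <= 2 * (t + k * a) <= a.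
Proof.
move=> a0; exists (- ((2 * t + a) %/ (2 * a))%Z).
have a2 : 2 * a != 0 by lia.
have := divz_eq (2 * t + a) (2 * a); have := modz_ge0 (2 * t + a) a2.
have := @ltz_pmod (2 * t + a) (2 * a); rewrite pmulr_rgt0 // => /(_ a0).
move: (_ %/ _)%Z (_ %% _)%Z => q r ? ? E.
have -> : 2 * (t + - q * a) = r - a by lia.
by lia.
Qed.

(** Gauss reduction: a translation makes the middle coefficient small, and an
    exchange decreases the first one as long as it exceeds the last one. At the
    end b^2 <= a^2 / 4 and a <= c give 3 a^2 <= 4 (a c - b^2). *)
Lemma binary_reduction (a b c : int) : 0 < a -> 0 < a * c - b ^+ 2 ->
  exists p q p' q' : int, p * q' - q * p' = 1 /\
    let a' := p ^+ 2 * a + 2 * p * q * b + q ^+ 2 * c in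
    0 < a' /\ 3 * a' ^+ 2 <= 4 * (a * c - b ^+ 2).
Proof.
have [n le_an] : exists n : nat, a <= n%:Z by exists `|a|%N; lia.
elim: n => [|n IHn] in a b c le_an * => a0 d0; first by lia.
have [k kb] := shift_small a b a0.
pose b1 := b + k * a; pose c1 := c + 2 * k * b + k ^+ 2 * a.
have dE : a * c1 - b1 ^+ 2 = a * c - b ^+ 2 by rewrite /b1 /c1; ring.
have c10 : 0 < c1.
  rewrite -(pmulr_rgt0 _ a0); have := sqr_ge0 b1; lia.
have [lt_c1a|le_ac1] := ltP c1 a.
  have d1 : 0 < c1 * a - (- b1) ^+ 2 by rewrite sqrrN mulrC dE.
  have [|p [q [p' [q' [D [P1 P2]]]]]] := IHn c1 (- b1) a _ c10 d1; first by lia.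
  exists (p * k - q), p, (p' * k - q'), p'; split; first by rewrite -D; ring.
  move=> a'; have a'E : a' = p ^+ 2 * c1 + 2 * p * q * (- b1) + q ^+ 2 * a.
    by rewrite /a' /c1 /b1; ring.
  by rewrite a'E; split=> //; rewrite -dE -(sqrrN b1) (mulrC a).
exists 1, 0, 0, 1; split=> // a'.
have -> : a' = a by rewrite /a'; ring.
split=> //; rewrite -dE.
have : a ^+ 2 <= a * c1 by rewrite expr2 ler_pM2l.
have : 4 * b1 ^+ 2 <= a ^+ 2; last by lia.
move: kb; rewrite -/b1 => kb; nia.
Qed.

(** Hermite reduction, by induction on the first coefficient a. The form a f is
    the square of a linear form in x, y, z plus a binary form in y, z of
    determinant a; reduce the latter, then translate the second basis vector so
    that t is small, and exchange the first two vectors if this decreases a.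
    When no exchange is possible, a = 1 and the remaining coefficients can be
    cleared. *)
Lemma unimodular_ternary_is_gram (a b c r s t : int) :
  0 < a -> 0 < a * b - t ^+ 2 ->
  a * b * c + 2 * r * s * t - a * r ^+ 2 - b * s ^+ 2 - c * t ^+ 2 = 1 ->
  is_gram a b c r s t.
Proof.
have [n le_an] : exists n : nat, a <= n%:Z by exists `|a|%N; lia.
elim: n => [|n IHn] in a b c r s t le_an * => a0 m0 d1; first by lia.
have dG : (a * b - t ^+ 2) * (a * c - s ^+ 2) - (a * r - s * t) ^+ 2 = a.
  by rewrite -[RHS]mulr1 -d1; ring.
have [|p [q [p' [q' [D]]]]] := binary_reduction (a * b - t ^+ 2) (a * r - s * t) (a * c - s ^+ 2) m0.
  by rewrite dG.
rewrite dG => -[g0 g2].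
apply: (is_gram_mix23 _ _ _ _ _ _ _ _ _ _ D).
set b1 := p ^+ 2 * b + _ + _; set c1 := p' ^+ 2 * b + _ + _.
set r1 := p * p' * b + _ + _; set s1 := p' * t + _; set t1 := p * t + _.
have gE : p ^+ 2 * (a * b - t ^+ 2) + 2 * p * q * (a * r - s * t) +
  q ^+ 2 * (a * c - s ^+ 2) = a * b1 - t1 ^+ 2 by rewrite /b1 /t1; ring.
have d1' : a * b1 * c1 + 2 * r1 * s1 * t1 - a * r1 ^+ 2 - b1 * s1 ^+ 2 - c1 * t1 ^+ 2 = 1.
  transitivity ((p * q' - q * p') ^+ 2 * (a * b * c + 2 * r * s * t - a * r ^+ 2
    - b * s ^+ 2 - c * t ^+ 2)); last by rewrite D d1 mulr1 expr1n.
  by rewrite /b1 /c1 /r1 /s1 /t1; ring.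
rewrite gE in g0 g2.
move: b1 c1 r1 s1 t1 g0 g2 d1' {gE} => {m0 d1 dG D p q p' q' b c r s t}.
move=> b c r s t g0 g2 d1.
have [k kt] := shift_small a t a0.
apply: (is_gram_shift12 k).
set b1 := b + _ + _; set r1 := r + _; set t1 := t + _ in kt *.
have gE : a * b - t ^+ 2 = a * b1 - t1 ^+ 2 by rewrite /b1 /t1; ring.
have d1' : a * b1 * c + 2 * r1 * s * t1 - a * r1 ^+ 2 - b1 * s ^+ 2 - c * t1 ^+ 2 = 1.
  by rewrite -[RHS]d1 /b1 /r1 /t1; ring.
rewrite gE in g0 g2.
move: b1 r1 t1 g0 g2 d1' kt {gE} => {d1 b r t}.
move=> b r t g0 g2 d1 kt.
have b0 : 0 < b by rewrite -(pmulr_rgt0 _ a0); have := sqr_ge0 t; lia.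
have [lt_ba|le_ab] := ltP b a.
  apply: is_gram_swap; apply: IHn => //; [lia | by rewrite mulrC | by rewrite -[RHS]d1; ring].
have t4 : 4 * t ^+ 2 <= a ^+ 2 by nia.
(* Combine a^2 <= a b, t^2 <= a^2 / 4 and 3 (a b - t^2)^2 <= 4 a to 27 a^3 <= 64. *)
have a34 : 3 * a ^+ 2 <= 4 * (a * b - t ^+ 2).
  have : a ^+ 2 <= a * b by rewrite expr2 ler_pM2l.
  lia.
have a1 : a = 1.
  have a4 : 9 * a ^+ 4 <= 16 * (a * b - t ^+ 2) ^+ 2.
    have -> : 9 * a ^+ 4 = (3 * a ^+ 2) ^+ 2 by ring.
    have -> : 16 * (a * b - t ^+ 2) ^+ 2 = (4 * (a * b - t ^+ 2)) ^+ 2 by ring.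
    by rewrite ler_sqr ?nnegrE //; have := sqr_ge0 a; lia.
  have a3 : 27 * a ^+ 3 <= 64.
    have : 27 * a ^+ 4 <= 64 * a by lia.
    have -> : 27 * a ^+ 4 = (27 * a ^+ 3) * a by ring.
    by rewrite ler_pM2r.
  have [a_lt1|a2|//] := ltgtP a 1; first by lia.
  have : 2 ^+ 3 <= a ^+ 3 by rewrite lerXn2r ?nnegrE //; lia.
  by lia.
move: kt g2 d1 g0; rewrite a1 => kt g2 d1 g0.
have t0 : t = 0 by lia.
move: g2 d1 g0; rewrite t0 => g2 d1 g0.
have b1 : b = 1 by nia.
apply: (is_gram_shift3 (- s) (- r)); rewrite b1.
have -> : c + 2 * - s * s + 2 * - r * r + (- s) ^+ 2 * 1 + (- r) ^+ 2 * 1 +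
   2 * - s * - r * 0 = 1 by rewrite -[RHS]d1 b1; ring.
have -> : r + - s * 0 + - r * 1 = 0 by ring.
have -> : s + - s * 1 + - r * 0 = 0 by ring.
by exists (1, 0, 0), (0, 1, 0), (0, 0, 1).
Qed.

(** With C = (B^2 + N) / q and be = - B / al mod N, the form
    ((N x + be y + al z)^2 + q z^2 + 2 B y z + C y^2) / N has integral
    coefficients and determinant 1, and it takes the value N at (1, 0, 0). *)
Lemma three_squares_of_mutual_residues (N q al B : int) :
  0 < N -> 0 < q -> coprimez q N ->
  (N %| al ^+ 2 + q)%Z -> (q %| B ^+ 2 + N)%Z ->
  exists x y z : int, N = x ^+ 2 + y ^+ 2 + z ^+ 2.
Proof.
move=> N0 q0 cop /dvdzP[a aE] /dvdzP[C CE].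
have copal : coprimez al N.
  have /coprimezP[[u v] /= E] := cop.
  apply/coprimezP; exists (- (u * al), u * a + v) => /=.
  by rewrite -[RHS]E; transitivity (u * (a * N - al ^+ 2) + v * N); [ring | rewrite -aE; ring].
have [be [h hE]] : exists be h : int, al * be + B = h * N.
  have /coprimezP[[u v] /= E] := copal.
  exists (- (B * u)), (B * v).
  transitivity (B * (1 - u * al)); first by ring.
  by rewrite -E; ring.
have [b bE] : exists b : int, be ^+ 2 + C = b * N.
  have : (N %| q * (be ^+ 2 + C))%Z.
    have -> : q * (be ^+ 2 + C) = (al ^+ 2 + q) * be ^+ 2 - (al * be) ^+ 2 + C * q by ring.
    rewrite aE -CE; have -> : al * be = h * N - B by rewrite -hE; ring.
    apply/dvdzP; exists (a * be ^+ 2 - h ^+ 2 * N + 2 * h * B + 1); ring.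
  by rewrite Gauss_dvdzr 1?coprimez_sym // => /dvdzP.
have [||u [_ [_ [[-> _ _] _]]]] := unimodular_ternary_is_gram N a b h be al N0; last first.
- by exists u.1.1, u.1.2, u.2; rewrite /dot3 !expr2.
- apply: (mulfI (lt0r_neq0 N0)); rewrite mulr1.
  transitivity ((a * N - al ^+ 2) * (b * N - be ^+ 2) - (h * N - al * be) ^+ 2); first by ring.
  rewrite -aE -bE -hE; transitivity (C * q - B ^+ 2); first by ring.
  by rewrite -CE; ring.
- by rewrite mulrC -aE; lia.
Qed.

(** * Quadratic characters and the hyperbola method *)

Definition real_char (k : nat) (chi : nat -> int) : Prop :=
  [/\ forall m n, chi (m * n)%N = chi m * chi n,
      forall n, chi (n %% k)%N = chi n,
      forall n, coprime n k -> chi n = 1 \/ chi n = -1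
    & forall n, ~~ coprime n k -> chi n = 0].

Lemma real_char_norm {k chi} n : real_char k chi -> `|chi n| <= 1.
Proof.
case=> _ _ c1 c0; case: (boolP (coprime n k)) => [/c1[]->|/c0->] //.
Qed.

(** Multiplication by c permutes the residues and changes the sign of the sum. *)
Lemma real_char_sum0 {k chi c} : (0 < k)%N -> real_char k chi -> chi c = -1 ->
  \sum_(i < k) chi i = 0.
Proof.
move=> k0 [cM cP c1 c0] cc.
have copc : coprime c k by case: (boolP (coprime c k)) => // /c0; rewrite cc.
pose f (i : 'I_k) : 'I_k := Ordinal (ltn_pmod (c * i) k0).
have f_inj : injective f.
  move=> i j /(congr1 val) /= /eqP.
  wlog le_ij : i j / (i <= j)%N.
    by move=> wl; case/orP: (leq_total i j) => /wl // h; rewrite eq_sym => /h ->.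
  rewrite eq_sym eqn_mod_dvd ?leq_mul2l ?le_ij ?orbT // -mulnBr Gauss_dvdr 1?coprime_sym //.
  move=> dv; apply: val_inj => /=; apply/eqP; rewrite eqn_leq le_ij /= -subn_eq0.
  have := dvdn_leq _ dv; have := ltn_ord j; case: (_ - _)%N (leq_subr i j) => // d dj jk /(_ isT).
  by rewrite leqNgt (leq_ltn_trans dj).
have : \sum_(i < k) chi i = - \sum_(i < k) chi i.
  rewrite {1}(reindex_inj f_inj) -sumrN; apply: eq_bigr => i _ /=.
  by rewrite cP cM cc mulN1r.
by lia.
Qed.

Lemma real_char_sum_le {k chi c} a b : (0 < k)%N -> real_char k chi -> chi c = -1 ->
  `|\sum_(a <= i < b) chi i| <= (2 * k)%:Z.
Proof.
move=> k0 chiR cc; pose P n := \sum_(0 <= i < n) chi i.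
have Pk n : P (k + n)%N = P n.
  rewrite /P (@big_cat_nat _ _ _ k) ?leq_addr //= big_mkord (real_char_sum0 k0 chiR cc) add0r.
  rewrite -{1}[k]add0n big_addn addKn; apply: eq_bigr => i _.
  by have [_ cP _ _] := chiR; rewrite -cP modnDr cP.
have Ple n : `|P n| <= k%:Z.
  elim/ltn_ind: n => n IH; have [lt_nk|le_kn] := ltnP n k.
    apply: le_trans (ler_norm_sum _ _ _) _.
    apply: (@le_trans _ _ (\sum_(0 <= i < n) 1)).
      by apply: ler_sum => i _; apply: real_char_norm chiR.
    by rewrite sumr_const_nat subn0; lia.
  by rewrite -(subnKC le_kn) Pk; apply: IH; lia.
have [le_ab|/ltnW le_ba] := leqP a b; last by rewrite big_geq // normr0.
have -> : \sum_(a <= i < b) chi i = P b - P a.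
  by rewrite /P [X in _ = X - _](@big_cat_nat _ _ _ a) //= addrAC subrr add0r.
have := Ple a; have := Ple b; lia.
Qed.

(** Summation by parts: the differences of the decreasing weights are nonnegative
    and telescope. *)
Lemma abel_summation_le {R : rcfType} (u w : nat -> R) (K : R) (a b : nat) :
  (forall c, (a <= c)%N -> `|\sum_(a <= n < c) u n| <= K) ->
  (forall n, (a <= n)%N -> 0 <= w n.+1 <= w n) -> 0 <= w a ->
  `|\sum_(a <= n < b) u n * w n| <= K * w a.
Proof.
move=> uK ww wa.
have K0 : 0 <= K by apply: le_trans (uK a (leqnn a)); rewrite normr_ge0.
have [le_ba|/ltnW le_ab] := leqP b a; first by rewrite big_geq // normr0 mulr_ge0.
pose S c := \sum_(a <= n < c) u n.
have E : \sum_(a <= n < b) u n * w n =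
    S b * w b + \sum_(a <= n < b) S n.+1 * (w n - w n.+1).
  elim: b le_ab => [|b IH]; first by rewrite leqn0 => /eqP ->; rewrite /S !big_geq // mul0r addr0.
  rewrite leq_eqVlt => /orP[/eqP <-|]; first by rewrite /S !big_geq // mul0r addr0.
  rewrite ltnS => le_ab; rewrite !big_nat_recr //= IH //.
  by rewrite /S big_nat_recr //=; ring.
have wb n : (a <= n)%N -> 0 <= w n.
  by case: n => [|n]; [rewrite leqn0 => /eqP <- | rewrite leq_eqVlt => /orP[/eqP <-//|/ww/andP[]]].
have -> : w a = w b + \sum_(a <= n < b) (w n - w n.+1).
  have := telescope_sumr w le_ab; have -> : \sum_(a <= n < b) (w n - w n.+1) =
     - \sum_(a <= n < b) (w n.+1 - w n) by rewrite -sumrN; apply: eq_bigr => i _; rewrite opprB.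
  by move=> ->; ring.
rewrite E mulrDr (le_trans (ler_normD _ _)) // lerD //.
  by rewrite normrM (ger0_norm (wb _ le_ab)) ler_wpM2r ?wb ?uK.
rewrite (le_trans (ler_norm_sum _ _ _)) // mulr_sumr big_nat_cond [leRHS]big_nat_cond.
apply: ler_sum => n; rewrite andbT => /andP[an nb].
have /andP[_ wn] := ww n an.
by rewrite normrM (@ger0_norm _ (_ - _)) ?subr_ge0 // ler_wpM2r ?subr_ge0 ?uK // ltnW.
Qed.

Definition dirichlet_conv (f g : nat -> int) (n : nat) : int :=
  \sum_(d <- divisors n) f d * g (n %/ d)%N.

Section Hyperbola.
Variable R : rcfType.
Implicit Types (u v : nat -> R).

(** The weight 1 / sqrt n is chosen because it is multiplicative and turns the sum
    over squares into a harmonic sum, while leaving the hyperbola sums below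
    bounded. *)
Definition isqrt (n : nat) : R := (Num.sqrt n%:R)^-1.

Lemma isqrt_ge0 n : 0 <= isqrt n.
Proof. by rewrite invr_ge0 sqrtr_ge0. Qed.

Lemma isqrt1 : isqrt 1 = 1.
Proof. by rewrite /isqrt sqrtr1 invr1. Qed.

Lemma isqrt_decr n : (0 < n)%N -> 0 <= isqrt n.+1 <= isqrt n.
Proof.
move=> n0; rewrite isqrt_ge0 lef_pV2 ?posrE ?sqrtr_gt0 ?ltr0n //.
by rewrite ler_sqrt ?ler_nat ?leqnSn ?ltr0n ?ler0n.
Qed.

Lemma isqrtM m n : isqrt (m * n) = isqrt m * isqrt n.
Proof. by rewrite /isqrt natrM sqrtrM ?ler0n // invfM. Qed.

Lemma isqrt_sqr n : isqrt (n ^ 2) = n%:R^-1.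
Proof. by rewrite /isqrt natrX sqrtr_sqr ger0_norm ?ler0n. Qed.

Lemma sum_isqrt_le n : \sum_(1 <= i < n.+1) isqrt i <= 2 * Num.sqrt n%:R.
Proof.
elim: n => [|n IH]; first by rewrite big_geq // mulr_ge0 ?sqrtr_ge0.
rewrite big_nat_recr //=; apply: le_trans (lerD IH (lexx _)) _.
set s := Num.sqrt n.+1%:R; set t := Num.sqrt n%:R.
have s0 : 0 < s by rewrite sqrtr_gt0 ltr0n.
have t0 : 0 <= t by rewrite sqrtr_ge0.
have st : s ^+ 2 = t ^+ 2 + 1 by rewrite !sqr_sqrtr ?ler0n // -natr1.
rewrite -lerBrDl -mulrBr -[isqrt _]mul1r ler_pdivrMr //.
have -> : 2 * (s - t) * s = 1 + (s - t) ^+ 2 + (s ^+ 2 - (t ^+ 2 + 1)) by ring.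
by rewrite st subrr addr0 lerDl sqr_ge0.
Qed.

Lemma sum_multiples (f : nat -> R) d X : (0 < d)%N ->
  \sum_(1 <= n < X.+1 | (d %| n)%N) f (n %/ d)%N = \sum_(1 <= b < (X %/ d).+1) f b.
Proof.
move=> d0; elim: X => [|X IH]; first by rewrite div0n !big_geq.
rewrite big_mkcond /= big_nat_recr //= -big_mkcond /= IH divnS //.
case: (d %| X.+1)%N; last by rewrite addr0.
by rewrite add1n [in RHS]big_nat_recr.
Qed.

(** A sum over n of a sum over the divisors of n is a sum over the lattice points
    (a, b) under the hyperbola a b <= X. *)
Lemma sum_dirichlet_conv (f g : nat -> int) X :
  \sum_(1 <= n < X.+1) (dirichlet_conv f g n)%:~R * isqrt n =
  \sum_(1 <= a < X.+1) ((f a)%:~R * isqrt a) *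
     \sum_(1 <= b < (X %/ a).+1) ((g b)%:~R * isqrt b).
Proof.
transitivity (\sum_(1 <= n < X.+1) \sum_(1 <= d < X.+1 | (d %| n)%N)
   (f d)%:~R * isqrt d * ((g (n %/ d)%N)%:~R * isqrt (n %/ d))).
  rewrite big_nat_cond [RHS]big_nat_cond; apply: eq_bigr => n; rewrite andbT => /andP[n1 nX].
  rewrite -[RHS]big_filter /dirichlet_conv rmorph_sum /= mulr_suml.
  rewrite (perm_big [seq i <- index_iota 1 X.+1 | (i %| n)%N]) /=; last first.
    apply: uniq_perm; rewrite ?divisors_uniq ?filter_uniq ?iota_uniq // => d.
    rewrite mem_filter mem_index_iota -dvdn_divisors //.
    by case dn: (d %| n)%N => //=; rewrite (dvdn_gt0 n1 dn) ltnS (leq_trans (dvdn_leq n1 dn)).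
  rewrite !big_filter; apply: eq_bigr => d dn; rewrite rmorphM /=.
  by rewrite -{2}(divnK dn) isqrtM; ring.
rewrite (exchange_big_dep_nat predT) //=; apply: eq_big_nat => a /andP[a1 aX].
rewrite mulr_sumr.
by rewrite -(sum_multiples (fun b => (f a)%:~R * isqrt a * ((g b)%:~R * isqrt b))).
Qed.

(** Dirichlet's hyperbola method: the points (a, b) with a b <= y^2 lie in the
    square a, b <= y, or in one of two tails where one coordinate exceeds y. On
    the tails the inner sums are O(1 / sqrt y), while the sum of 1 / sqrt a over
    a <= y is O(sqrt y). *)
Lemma hyperbola_bound u v (K : R) y :
  (forall a b, (0 < a)%N -> `|\sum_(a <= n < b) u n| <= K * isqrt a) ->
  (forall a b, (0 < a)%N -> `|\sum_(a <= n < b) v n| <= K * isqrt a) ->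
  (forall n, `|u n| <= isqrt n) -> (forall n, `|v n| <= isqrt n) ->
  (0 < y)%N ->
  `|\sum_(1 <= a < (y ^ 2).+1) u a * \sum_(1 <= b < (y ^ 2 %/ a).+1) v b|
     <= K ^+ 2 + 4 * K.
Proof.
move=> uK vK u1 v1 y0; set X := (y ^ 2)%N.
have K0 : 0 <= K.
  by have := uK 1%N 1%N isT; rewrite big_geq // normr0 isqrt1 mulr1.
have yX : (y <= X)%N by rewrite /X expnS expn1 leq_pmulr.
rewrite (@big_cat_nat _ _ _ y.+1) //=.
have -> : \sum_(1 <= a < y.+1) u a * \sum_(1 <= b < (X %/ a).+1) v b =
    (\sum_(1 <= a < y.+1) u a) * (\sum_(1 <= b < y.+1) v b) +
    \sum_(1 <= a < y.+1) u a * \sum_(y.+1 <= b < (X %/ a).+1) v b.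
  rewrite mulr_suml -big_split /=; apply: eq_big_nat => a /andP[a1 ay].
  rewrite -mulrDr -big_cat_nat //= ltnS leq_divRL // /X expnS expn1.
  by rewrite leq_mul2l -ltnS ay orbT.
have -> : \sum_(y.+1 <= a < X.+1) u a * \sum_(1 <= b < (X %/ a).+1) v b =
    \sum_(1 <= b < y.+1) v b * \sum_(y.+1 <= a < (X %/ b).+1) u a.
  transitivity (\sum_(y.+1 <= a < X.+1) \sum_(1 <= b < y.+1 | (a * b <= X)%N) u a * v b).
    apply: eq_big_nat => a /andP[ya aX]; have a0 : (0 < a)%N by apply: leq_trans ya.
    rewrite mulr_sumr (@big_nat_widen _ _ _ _ _ y.+1) /=.
      by apply: eq_bigl => b; rewrite ltnS leq_divRL // mulnC.
    by rewrite ltn_divLR // /X expnS expn1 ltn_mul // ltnS.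
  rewrite (exchange_big_dep_nat predT) //=; apply: eq_big_nat => b /andP[b1 bX].
  rewrite mulr_sumr [RHS](@big_nat_widen _ _ _ _ _ X.+1) /=; last by rewrite ltnS leq_div.
  apply: eq_big => [a|a _]; last by rewrite mulrC.
  by rewrite ltnS leq_divRL.
have sq0 : 0 < Num.sqrt y%:R :> R by rewrite sqrtr_gt0 ltr0n.
have tail (s t : nat -> R) : (forall n, `|s n| <= isqrt n) ->
    (forall a b, (0 < a)%N -> `|\sum_(a <= n < b) t n| <= K * isqrt a) ->
    `|\sum_(1 <= a < y.+1) s a * \sum_(y.+1 <= b < (X %/ a).+1) t b| <= 2 * K.
  move=> s1 tK; rewrite (le_trans (ler_norm_sum _ _ _)) //.
  apply: (@le_trans _ _ (\sum_(1 <= a < y.+1) isqrt a * (K * isqrt y))).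
    apply: ler_sum => a _; rewrite normrM ler_pM //.
    apply: le_trans (tK _ _ _) _ => //; rewrite ler_wpM2l //.
    by case/andP: (isqrt_decr _ y0).
  rewrite -mulr_suml.
  apply: le_trans (ler_wpM2r _ (sum_isqrt_le y)) _; first by rewrite mulr_ge0 ?isqrt_ge0.
  rewrite [leLHS](_ : _ = 2 * K * (Num.sqrt y%:R / Num.sqrt y%:R)).
    by rewrite (divff (lt0r_neq0 sq0)) mulr1.
  by rewrite /isqrt; ring.
have U1 (t : nat -> R) :
    (forall a b, (0 < a)%N -> `|\sum_(a <= n < b) t n| <= K * isqrt a) ->
    `|\sum_(1 <= a < y.+1) t a| <= K.
  move=> tK; have := tK 1%N y.+1 isT.
  by rewrite isqrt1 mulr1.
have -> : K ^+ 2 + 4 * K = (K * K + 2 * K) + 2 * K by ring.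
rewrite (le_trans (ler_normD _ _)) // lerD ?tail //.
rewrite (le_trans (ler_normD _ _)) // lerD ?tail //.
by rewrite normrM ler_pM // U1.
Qed.
End Hyperbola.

(** * Positivity of the convolution of two quadratic characters *)

Lemma real_char1 {k chi} : real_char k chi -> chi 1%N = 1.
Proof.
case=> cM _ c1 _; have := cM 1%N 1%N; rewrite muln1.
by have [|->|->] := c1 1%N; first by rewrite coprime1n.
Qed.

Lemma real_charX {k chi} m n : real_char k chi -> chi (m ^ n)%N = chi m ^+ n.
Proof.
move=> chiR; have [cM _ _ _] := chiR.
by elim: n => [|n IH]; rewrite ?expn0 ?expr0 ?(real_char1 chiR) // expnS exprS cM IH.
Qed.

(** The induction scheme for multiplicative functions. *)
Lemma prime_power_ind (P : nat -> Prop) :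
  P 1%N ->
  (forall p e n, prime p -> (0 < e)%N -> ~~ (p %| n)%N -> (0 < n)%N -> P n -> P (p ^ e * n)%N) ->
  forall n, (0 < n)%N -> P n.
Proof.
move=> P1 PM; elim/ltn_ind => n IH n0.
have [->//|n1] : n = 1%N \/ (1 < n)%N by lia.
have pp := pdiv_prime n1; set p := pdiv n in pp.
have [m npm nE] := pfactor_coprime pp n0.
have e0 : (0 < logn p n)%N by rewrite logn_gt0 mem_primes pp n0 pdiv_dvd.
have m0 : (0 < m)%N by move: n0; rewrite nE muln_gt0 => /andP[].
rewrite nE mulnC; apply: PM => //; first by rewrite -prime_coprime.
apply: IH => //; rewrite nE -[ltnLHS]muln1 ltn_pmul2l //.
by rewrite -(exp1n (logn p n)) ltn_exp2r // prime_gt1.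
Qed.

Lemma perm_divisors_prime_power p e n : prime p -> ~~ (p %| n)%N -> (0 < n)%N ->
  perm_eq (divisors (p ^ e * n)) [seq (p ^ i * d)%N | i <- iota 0 e.+1, d <- divisors n].
Proof.
move=> pp npn n0; have p0 := prime_gt0 pp.
have log_d i d : (d %| n)%N -> logn p (p ^ i * d) = i.
  move=> dn; have d0 := dvdn_gt0 n0 dn.
  rewrite lognM ?expn_gt0 ?p0 // pfactorK // lognE pp d0 /=.
  by rewrite (negbTE (contra (fun h => dvdn_trans h dn) npn)) addn0.
apply: uniq_perm; first exact: divisors_uniq.
  apply: allpairs_uniq; rewrite ?iota_uniq ?divisors_uniq //.
  move=> [i d] [j d'] /allpairsP[[i0 d0] [_ dn [-> ->]]] /allpairsP[[j0 d0'] [_ dn' [-> ->]]] /=.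
  move: dn dn'; rewrite /= -!dvdn_divisors // => dn dn' E.
  have ij : i0 = j0 by rewrite -(log_d i0 d0) // E log_d.
  by move: E; rewrite ij => /eqP; rewrite eqn_pmul2l ?expn_gt0 ?p0 // => /eqP ->.
move=> x; rewrite -dvdn_divisors ?muln_gt0 ?expn_gt0 ?p0 //; apply/idP/allpairsP.
  move=> xn; have x0 : (0 < x)%N by apply: dvdn_gt0 xn; rewrite muln_gt0 expn_gt0 p0.
  have [m npm xE] := pfactor_coprime pp x0.
  exists (logn p x, m); split; last by rewrite /= {1}xE mulnC.
    rewrite mem_iota add0n ltnS [_.1]/=.
    by have := dvdn_leq_log p _ xn; rewrite log_d //; apply; rewrite muln_gt0 expn_gt0 p0.
  rewrite [_.2]/= -dvdn_divisors //.
  have : (m %| p ^ e * n)%N by apply: dvdn_trans xn; rewrite xE dvdn_mulr.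
  by rewrite Gauss_dvdr // coprimeXr // coprime_sym.
case=> -[i d] [ie]; rewrite [_.2]/= -dvdn_divisors // => dn ->.
by rewrite dvdn_mul // dvdn_exp2l //; move: ie; rewrite mem_iota add0n ltnS.
Qed.

Lemma dirichlet_conv_prime_power {k f g} p e n :
  real_char k f -> real_char k g -> prime p -> ~~ (p %| n)%N -> (0 < n)%N ->
  dirichlet_conv f g (p ^ e * n) =
  (\sum_(i < e.+1) f p ^+ i * g p ^+ (e - i)) * dirichlet_conv f g n.
Proof.
move=> fR gR pp npn n0; have [fM _ _ _] := fR; have [gM _ _ _] := gR.
rewrite /dirichlet_conv (perm_big _ (perm_divisors_prime_power p e n pp npn n0)).
rewrite big_allpairs_dep (_ : iota 0 e.+1 = index_iota 0 e.+1); last by rewrite /index_iota subn0.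
rewrite big_mkord mulr_suml.
apply: eq_bigr => i _; rewrite mulr_sumr !big_seq; apply: eq_bigr => d dn.
have dn' : (d %| n)%N by rewrite dvdn_divisors.
have -> : (p ^ e * n %/ (p ^ i * d) = p ^ (e - i) * (n %/ d))%N.
  have ie : (i <= e)%N by rewrite -ltnS.
  rewrite -{1}(subnK ie) expnD -{1}(divnK dn').
  rewrite [X in (X %/ _)%N](_ : _ = (p ^ (e - i) * (n %/ d)) * (p ^ i * d))%N.
    by rewrite mulnK // muln_gt0 expn_gt0 prime_gt0 // (dvdn_gt0 n0 dn').
  by rewrite mulnACA mulnA.
by rewrite fM gM !(real_charX _ _ fR) !(real_charX _ _ gR); ring.
Qed.

Lemma sum_signs e : \sum_(i < e.+1) (-1) ^+ i = (~~ odd e)%:R :> int.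
Proof.
elim: e => [|e IH]; first by rewrite big_ord1.
by rewrite big_ord_recr /= IH -signr_odd /=; case: (odd e).
Qed.

(** The local factor of f * g at p^e, for (s, t) = (f p, g p), is e + 1 if both
    values are 1, and 1 or 0 according to the parity of e if they are opposite;
    only (s, t) = (-1, -1) can make it negative. *)
Lemma prime_power_factor (s t : int) e :
  [|| (s, t) == (1, 1), (s, t) == (1, -1) | (s, t) == (-1, 1)] ->
  (~~ odd e)%:R <= \sum_(i < e.+1) s ^+ i * t ^+ (e - i).
Proof.
case/or3P => /eqP[-> ->].
- rewrite (eq_bigr (fun=> 1)) => [|i _]; last by rewrite !expr1n.
  by rewrite sumr_const card_ord; case: (odd e); lia.
- rewrite (eq_bigr (fun i : 'I_e.+1 => (-1) ^+ e * (-1) ^+ i)) => [|i _].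
    by rewrite -mulr_sumr sum_signs -signr_odd; case: (odd e).
  have ie : (i <= e)%N by rewrite -ltnS.
  have -> : (-1) ^+ e = (-1) ^+ (e - i) * (-1) ^+ i :> int by rewrite -exprD subnK.
  by rewrite expr1n mul1r -mulrA -expr2 sqrr_sign mulr1.
- by rewrite (eq_bigr (fun i : 'I_e.+1 => (-1) ^+ i)) ?sum_signs // => i _; rewrite expr1n mulr1.
Qed.

Section NoCommonMinusOne.
Variables (k : nat) (f g : nat -> int).
Hypotheses (fR : real_char k f) (gR : real_char k g).
Hypothesis no_mm : forall p, prime p -> ~ (f p = -1 /\ g p = -1).

Lemma coprime_prime_factor p e : prime p -> coprime p k ->
  (~~ odd e)%:R <= \sum_(i < e.+1) f p ^+ i * g p ^+ (e - i).
Proof.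
move=> pp pk; apply: prime_power_factor.
have [_ _ f1 _] := fR; have [_ _ g1 _] := gR.
by have := no_mm p pp; case: (f1 _ pk) => ->; case: (g1 _ pk) => -> // [].
Qed.

Lemma dirichlet_conv_ge0 n : (0 < n)%N -> 0 <= dirichlet_conv f g n.
Proof.
move: n; apply: prime_power_ind.
  by rewrite /dirichlet_conv big_seq1 (real_char1 fR) (real_char1 gR).
move=> p e n pp e0 npn n0 IH; rewrite (dirichlet_conv_prime_power _ _ _ fR gR) // mulr_ge0 //.
case: (boolP (coprime p k)) => pk.
  by apply: le_trans (coprime_prime_factor p e pp pk); case: odd.
have [_ _ _ f0] := fR; have [_ _ _ g0] := gR; rewrite f0 // g0 //.
by apply: sumr_ge0 => i _; rewrite mulr_ge0 ?exprn_ge0.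
Qed.

Lemma dirichlet_conv_sqr_ge1 n : (0 < n)%N -> coprime n k -> 1 <= dirichlet_conv f g (n ^ 2).
Proof.
move: n; apply: prime_power_ind.
  by rewrite /dirichlet_conv big_seq1 (real_char1 fR) (real_char1 gR).
move=> p e n pp e0 npn n0 IH; rewrite coprimeMl coprime_pexpl // => /andP[pk nk].
rewrite expnMn -expnM (dirichlet_conv_prime_power _ _ _ fR gR) //; last 2 first.
- by rewrite Euclid_dvdX // (negbTE npn).
- by rewrite expn_gt0 n0.
rewrite -[leLHS]mulr1 ler_pM ?IH //.
by apply: le_trans (coprime_prime_factor p _ pp pk); rewrite mulnC mul2n odd_double.
Qed.
End NoCommonMinusOne.

(** Oresme's dyadic blocks: the terms with 2^t < j <= 2^(t+1) add up to at least
    1 / (2 (k + 1)). *)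
Lemma harmonic_progression (R : realFieldType) k t :
  t%:R / (2 * k.+1%:R) <= \sum_(1 <= j < (2 ^ t).+1) (j * k + 1)%:R^-1 :> R.
Proof.
have k0 : 0 < 2 * k.+1%:R :> R by rewrite mulr_gt0 ?ltr0n.
elim: t => [|t IH]; first by rewrite mul0r sumr_ge0 // => i _; rewrite invr_ge0.
rewrite (@big_cat_nat _ _ _ (2 ^ t).+1) //=; last by rewrite ltnS leq_exp2l.
rewrite -natr1 mulrDl lerD //.
have -> : 1 / (2 * k.+1%:R) = \sum_((2 ^ t).+1 <= j < (2 ^ t.+1).+1) (2 ^ t.+1 * k.+1)%:R^-1 :> R.
  rewrite sumr_const_nat subSS expnS mul2n -addnn addKn addnn -mul2n.
  rewrite -mulr_natl !natrM !invfM.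
  have t0 : (2 ^ t)%:R != 0 :> R by rewrite pnatr_eq0 -lt0n expn_gt0.
  by field; rewrite t0 nat1r pnatr_eq0.
rewrite [leLHS]big_nat_cond [leRHS]big_nat_cond; apply: ler_sum => j; rewrite andbT => /andP[jt jt1].
rewrite lef_pV2 ?posrE ?ltr0n ?addn1 // ?muln_gt0 ?expn_gt0 // ler_nat.
by nia.
Qed.

(** * A prime where two quadratic characters are -1 *)

Lemma ler_sum_seq_sub (R : numDomainType) (m n : nat) (s : seq nat) (F : nat -> R) :
  uniq s -> (forall i, i \in s -> (m <= i < n)%N) ->
  (forall i, (m <= i < n)%N -> 0 <= F i) ->
  \sum_(i <- s) F i <= \sum_(m <= i < n) F i.
Proof.
move=> us sI F0; rewrite [leRHS](bigID (mem s)) /=.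
have -> : \sum_(i <- s) F i = \sum_(m <= i < n | i \in s) F i.
  rewrite -[RHS]big_filter; apply: perm_big; apply: uniq_perm => //.
    by rewrite filter_uniq ?iota_uniq.
  by move=> i; rewrite mem_filter mem_index_iota; case: (boolP (i \in s)) => // /sI ->.
rewrite lerDl big_nat_cond; apply: sumr_ge0 => i /andP[im _]; exact: F0.
Qed.

(** If no prime had both values -1, the sum of (f * g)(n) / sqrt n over n <= y^2
    would be at least the sum of 1 / m over the m <= y prime to k, hence unbounded,
    against the hyperbola bound. The characters f and g are nontrivial thanks to c
    and c', so that their sums over intervals are bounded by 2 k. *)
Lemma prime_both_minus_one (k : nat) (f g : nat -> int) (c c' : nat) :
  (0 < k)%N -> real_char k f -> real_char k g -> f c = -1 -> g c' = -1 ->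
  exists p : nat, [/\ prime p, f p = -1 & g p = -1].
Proof.
move=> k0 fR gR fc gc; apply: contrapT => none.
have no_mm p : prime p -> ~ (f p = -1 /\ g p = -1).
  by move=> pp [fp gp]; apply: none; exists p.
pose K : realalg := (2 * k)%:R.
have bound h d : real_char k h -> h d = -1 -> forall a b, (0 < a)%N ->
    `|\sum_(a <= n < b) (h n)%:~R * isqrt realalg n| <= K * isqrt realalg a.
  move=> hR hd a b a0; apply: abel_summation_le; rewrite ?isqrt_ge0 //.
    move=> e _; rewrite -rmorph_sum /= -intr_norm.
    by rewrite /K (_ : _%:R = (2 * k)%:Z%:~R) // ler_int (real_char_sum_le _ _ k0 hR hd).
  by move=> n an; apply: isqrt_decr; apply: leq_trans an.
have small h n : real_char k h -> `|(h n)%:~R * isqrt realalg n| <= isqrt realalg n.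
  move=> hR; rewrite normrM (ger0_norm (isqrt_ge0 _ n)) ler_piMl ?isqrt_ge0 //.
  by rewrite -intr_norm -[1]/(1%:~R) ler_int (real_char_norm _ hR).
(* With K = 2 k the hyperbola bound is K^2 + 4 K = 4 k^2 + 8 k. *)
pose t := (2 * k.+1 * (4 * k ^ 2 + 8 * k)).+1; pose y := (2 ^ t * k + 1)%N.
have y0 : (0 < y)%N by rewrite /y addn1.
have := hyperbola_bound realalg _ _ K y (bound f c fR fc) (bound g c' gR gc)
  (fun n => small f n fR) (fun n => small g n gR) y0.
rewrite -sum_dirichlet_conv => /(le_trans (ler_norm _)).
pose F n := (dirichlet_conv f g n)%:~R * isqrt realalg n.
rewrite -/(F _) leNgt => /negP; apply.
apply: (@lt_le_trans _ _ (t%:R / (2 * k.+1%:R))).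
  rewrite ltr_pdivlMr ?mulr_gt0 ?ltr0n //.
  rewrite (_ : _ * _ = (2 * k.+1 * (4 * k ^ 2 + 8 * k))%:R); first by rewrite ltr_nat.
  by rewrite /K !(natrM, natrD, natrX); ring.
apply: le_trans (harmonic_progression _ k t) _.
(* Only the squares of the numbers j k + 1, which are prime to k, are kept. *)
pose sq (j : nat) := ((j * k + 1) ^ 2)%N.
apply: (@le_trans _ _ (\sum_(n <- [seq sq j | j <- index_iota 1 (2 ^ t).+1]) F n)).
  rewrite big_map; apply: ler_sum => j _.
  rewrite /F /sq isqrt_sqr -[leLHS]mul1r ler_wpM2r ?invr_ge0 ?ler0n //.
  rewrite -[1]/(1%:~R) ler_int (dirichlet_conv_sqr_ge1 k f g fR gR no_mm) ?addn1 //.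
  by rewrite -coprime_modl -addn1 modnMDl coprime_modl coprime1n.
apply: ler_sum_seq_sub.
- rewrite map_inj_uniq ?iota_uniq // => i j /eqP.
  by rewrite /sq eqn_exp2r // eqn_add2r eqn_pmul2r // => /eqP.
- move=> i /mapP[j]; rewrite mem_index_iota ltnS => /andP[j1 jt] ->.
  by rewrite ltnS /sq expn_gt0 addn1 leq_exp2r // /y addn1 !ltnS leq0n leq_mul2r jt orbT.
- move=> n /andP[n0 _]; rewrite mulr_ge0 ?isqrt_ge0 // -[0]/(0%:~R) ler_int.
  exact: (dirichlet_conv_ge0 k f g fR gR no_mm).
Qed.

(** * Quadratic characters separate classes modulo squares *)

(** A subgroup H that is maximal among those containing W and avoiding c has index
    2: for x outside H, the union of H and x H is a group because x^2 is in H, so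
    maximality puts c in x H; hence the complement of H is a single coset. *)
Lemma index2_separation (gT : finGroupType) (W : {group gT}) (c : gT) :
  (forall x y : gT, x * y = y * x)%g -> (forall x : gT, x ^+ 2 \in W)%g -> c \notin W ->
  exists H : {group gT}, [/\ W \subset H, c \notin H &
    forall x y, ((x * y)%g \notin H) = (x \notin H) (+) (y \notin H)].
Proof.
move=> comm sqW cW.
have [H /maxgroupP[/andP[WH cH] maxH] _] :=
  @maxgroup_exists _ (fun H : {group gT} => (W \subset H) && (c \notin H)) W
    (introT andP (conj (subxx W) cW)).
exists H; split=> // x y.
have sqH z : (z * z)%g \in H by apply: (subsetP WH); apply: sqW.
have cosetc z : z \notin H -> exists2 h, h \in H & c = (z * h)%g.
  move=> zH; pose H' := (H :|: z *: H)%g.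
  have H'g : group_set H'.
    apply/group_setP; split=> [|u v]; first by rewrite inE group1.
    rewrite !inE => /orP[uH|/lcosetP[u' uH ->]] /orP[vH|/lcosetP[v' vH ->]].
    - by rewrite groupM.
    - by apply/orP; right; rewrite mulgA (comm u) -mulgA mem_lcoset mulKg groupM.
    - by apply/orP; right; rewrite -mulgA mem_lcoset mulKg groupM.
    - have -> : (z * u' * (z * v') = z * z * (u' * v'))%g.
        by rewrite !mulgA; congr (_ * _)%g; rewrite -!mulgA (comm u').
      by rewrite groupM ?sqH ?groupM.
  have H'z : z \in H' by rewrite !inE lcoset_refl orbT.
  case: (boolP (c \in H')) => [|cH'].
    by rewrite inE (negbTE cH) => /lcosetP[h hH ->]; exists h.
  have := maxH (Group H'g); rewrite /= cH' andbT => /(_ _ _) E.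
  move: zH; rewrite -E ?H'z //; last by rewrite subsetUl.
  by apply: subset_trans WH (subsetUl _ _).
case: (boolP (x \in H)) => xH /=; first by rewrite groupMl.
case: (boolP (y \in H)) => yH /=; first by rewrite groupMr // xH.
have [h hH ch] := cosetc x xH; have [h' hH' ch'] := cosetc y yH.
have -> : (x * y = c * c * (h * h')^-1)%g.
  rewrite {1}ch ch'; apply: (canRL (mulgK _)).
  by rewrite -!mulgA (mulgA y h) (comm y h) -!mulgA.
by apply/negbF; rewrite groupM ?sqH // groupV groupM.
Qed.

Definition zmod_unit (k n : nat) : option {unit 'Z_k} := insub (n%:R : 'Z_k).

Lemma zmod_unitP {k} n : (1 < k)%N -> coprime n k ->
  exists2 u : {unit 'Z_k}, zmod_unit k n = Some u & val u = n%:R.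
Proof.
move=> k1 nk; have un : (n%:R : 'Z_k) \is a GRing.unit by rewrite unitZpE // coprime_sym.
rewrite /zmod_unit; case: insubP => [u _ uE|]; last by rewrite un.
by exists u.
Qed.

(** The character is -1 exactly outside an index 2 subgroup of the units modulo k
    that contains the classes in W and avoids c. *)
Lemma real_char_separation (k c : nat) (W : nat -> Prop) :
  (1 < k)%N -> (forall n, W (n %% k)%N <-> W n) ->
  (forall m n, coprime m k -> coprime n k -> W m -> W n -> W (m * n)%N) ->
  (forall n, coprime n k -> W (n ^ 2)%N) ->
  coprime c k -> ~ W c ->
  exists chi, [/\ real_char k chi, forall n, coprime n k -> W n -> chi n = 1 & chi c = -1].
Proof.
move=> k1 Wmod WM Wsq ck cW.
pose rep (u : {unit 'Z_k}) : nat := val (val u).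
have rep_coprime u : coprime (rep u) k.
  by have := valP u; rewrite -{1}[val u]natr_Zp unitZpE // coprime_sym.
have repE n u : val u = n%:R -> rep u = (n %% k)%N by rewrite /rep => ->; apply: val_Zp_nat.
have repM u v : rep (u * v)%g = (rep u * rep v %% k)%N by apply: repE; rewrite natrM !natr_Zp.
pose WU := [set u : {unit 'Z_k} | `[<W (rep u)>]].
have WUg : group_set WU.
  apply/group_setP; split=> [|u v]; rewrite !inE.
    apply/asboolP; rewrite (repE 1%N) // Wmod -(exp1n 2); apply: Wsq; exact: coprime1n.
  by move=> /asboolP uW /asboolP vW; apply/asboolP; rewrite repM Wmod; apply: WM.
have [uc Ec vc] := zmod_unitP c k1 ck.
have [|||H [WH cH Hxor]] := @index2_separation _ (Group WUg) uc.
- by move=> x y; apply: val_inj; rewrite /= mulrC.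
- move=> x; rewrite inE; apply/asboolP; rewrite expgS expg1 repM Wmod -[(_ * _)%N]/(_ ^ 2)%N.
  exact: Wsq.
- by rewrite inE; apply/asboolP; rewrite (repE c) // Wmod.
pose chi n := if zmod_unit k n is Some u then (-1) ^+ (u \notin H) else 0 : int.
have chi0 n : ~~ coprime n k -> chi n = 0.
  rewrite /chi /zmod_unit => nk; case: insubP => [u nu _|//].
  by move: nu; rewrite unitZpE // coprime_sym (negbTE nk).
exists chi; split; last by rewrite /chi Ec cH.
- split=> [m n|n|n nk|//].
  + case: (boolP (coprime m k)) => mk; last by rewrite (chi0 m) ?mul0r ?chi0 // coprimeMl (negbTE mk).
    case: (boolP (coprime n k)) => nk.
      have [u Eu mu] := zmod_unitP m k1 mk; have [v Ev nv] := zmod_unitP n k1 nk.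
      have [|w Ew mnw] := zmod_unitP (m * n) k1; first by rewrite coprimeMl mk.
      have wE : w = (u * v)%g by apply: val_inj; rewrite mnw /= mu nv natrM.
      by rewrite /chi Eu Ev Ew wE Hxor signr_addb.
    by rewrite (chi0 n) ?mulr0 ?chi0 // coprimeMl mk.
  + by rewrite /chi /zmod_unit Zp_nat_mod.
  + by rewrite /chi; case: (zmod_unitP n k1 nk) => u -> _; case: (u \notin H); [right|left].
- move=> n nk nW; have [u En un] := zmod_unitP n k1 nk; rewrite /chi En.
  have -> : u \in H by apply: (subsetP WH); rewrite inE; apply/asboolP; rewrite (repE n) // Wmod.
  by [].
Qed.

(** * The quadratic character of a prime field *)

Lemma finField_prim_root (F : finFieldType) : {z : F | #|F|.-1.-primitive_root z}.
Proof.
have F1 : (0 < #|F|.-1)%N by rewrite -ltnS prednK ?finNzRing_gt1 // ltnW ?finNzRing_gt1.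
have unitE (x : F) : x != 0 -> x ^+ #|F|.-1 = 1.
  by move=> x0; apply: (mulIf x0); rewrite -exprSr prednK ?expf_card ?mul1r // (ltnW (finNzRing_gt1 F)).
have : has #|F|.-1.-primitive_root (enum (predC1 (0 : F))).
  apply: has_prim_root => //; rewrite ?enum_uniq //.
    by apply/allP => x; rewrite mem_enum unity_rootE => /unitE ->.
  by rewrite -cardE cardC1.
by move=> /hasP/sig2W[z _ zP]; exists z.
Qed.

Lemma exists_root_of_unity (q n : nat) : prime q -> (0 < n)%N -> coprime q n ->
  exists F : finFieldType, q \in [pchar F] /\ exists z : F, n.-primitive_root z.
Proof.
move=> qp n0 qn; have tot0 : (0 < totient n)%N by rewrite totient_gt0.
have [F charF cardF] := PrimePowerField qp tot0.
exists F; split=> //; have [w wP] := finField_prim_root F.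
exists (w ^+ (#|F|.-1 %/ n)); apply: dvdn_prim_root => //.
rewrite cardF -subn1 -eqn_mod_dvd ?expn_gt0 ?prime_gt0 //.
by apply/eqP; rewrite Euler_exp_totient.
Qed.

(** By Euler's criterion this is the Legendre symbol; in this form it is visibly
    multiplicative. *)
Definition quad_char (p : nat) (x : 'F_p) : int :=
  if x == 0 then 0 else if x ^+ p.-1./2 == 1 then 1 else -1.

Lemma intr_eq0_pchar (F : nzRingType) (p : nat) (m : int) :
  p \in [pchar F] -> (m%:~R == 0 :> F) = (p %| m)%Z.
Proof.
move=> pF; rewrite dvdzE; case: m => n; first by rewrite -(dvdn_pcharf pF).
by rewrite NegzE mulrNz oppr_eq0 abszN -(dvdn_pcharf pF).
Qed.

Section OddPrime.
Variable p : nat.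
Hypotheses (pp : prime p) (p_odd : odd p).

Lemma half_prime : p.-1 = (p.-1./2).*2.
Proof. by rewrite -[LHS]odd_double_half; move: p_odd; case: (p) => // n /=; case: odd. Qed.

Lemma odd_pchar_neqN1 (F : fieldType) : p \in [pchar F] -> (1 : F) != -1.
Proof.
move=> pF; rewrite -addr_eq0 -[1 + 1]/(2%:R) -(dvdn_pcharf pF).
by apply/negP => /dvdn_leq; have := odd_prime_gt2 p_odd pp; lia.
Qed.

Lemma mem_pchar_Fp : p \in [pchar 'F_p]. Proof. by rewrite pchar_Fp. Qed.

Lemma Fp_expf (x : 'F_p) : x != 0 -> x ^+ p.-1 = 1.
Proof.
move=> x0; apply: (mulIf x0); rewrite -exprSr prednK ?prime_gt0 // mul1r.
by have := expf_card x; rewrite (card_Fp pp).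
Qed.

Lemma half_pow_sign (x : 'F_p) : x != 0 -> (x ^+ p.-1./2 == 1) || (x ^+ p.-1./2 == -1).
Proof.
by move=> x0; rewrite -sqrf_eq1 -exprM muln2 -half_prime Fp_expf.
Qed.

Lemma quad_charE (x : 'F_p) : (quad_char p x)%:~R = x ^+ p.-1./2.
Proof.
rewrite /quad_char; case: eqP => [->|/eqP/half_pow_sign].
  rewrite expr0n; have := half_prime; have := odd_prime_gt2 p_odd pp.
  by case: (_./2) => //; lia.
by case: eqP => [->|_ /eqP ->].
Qed.

(** In odd characteristic, 0, 1 and -1 are distinct: identities between quadratic
    characters may be checked in a field. *)
Lemma sign_inj (F : fieldType) (a b : int) : p \in [pchar F] ->
  a \in [:: 0; 1; -1] -> b \in [:: 0; 1; -1] -> a%:~R = b%:~R :> F -> a = b.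
Proof.
move=> /odd_pchar_neqN1 ne; rewrite !inE.
move=> /or3P[] /eqP-> /or3P[] /eqP-> //= /eqP; rewrite ?mulrN1z ?mulr1z ?mulr0z.
- by rewrite eq_sym oner_eq0.
- by rewrite eq_sym oppr_eq0 oner_eq0.
- by rewrite oner_eq0.
- by rewrite (negbTE ne).
- by rewrite oppr_eq0 oner_eq0.
- by rewrite eq_sym (negbTE ne).
Qed.

Lemma quad_char_val (x : 'F_p) : quad_char p x \in [:: 0; 1; -1].
Proof. by rewrite /quad_char !inE; do 2?case: ifP. Qed.

Lemma quad_charM (x y : 'F_p) : quad_char p (x * y) = quad_char p x * quad_char p y.
Proof.
apply: (sign_inj 'F_p); rewrite ?mem_pchar_Fp ?quad_char_val //.
  by have := quad_char_val x; have := quad_char_val y; rewrite !inE => /or3P[]/eqP-> /or3P[]/eqP->.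
by rewrite rmorphM /= !quad_charE exprMn.
Qed.

Lemma quad_char_sign (x : 'F_p) : x != 0 -> quad_char p x = 1 \/ quad_char p x = -1.
Proof. by rewrite /quad_char => /negbTE ->; case: ifP; [left | right]. Qed.

(** In terms of a primitive root z, an element z^i has trivial quadratic character
    exactly when i is even. *)
Lemma quad_char_sqrt (x : 'F_p) : quad_char p x = 1 -> exists y, y ^+ 2 = x.
Proof.
move=> x1; have x0 : x != 0 by apply/negP => /eqP x0; move: x1; rewrite x0 /quad_char eqxx.
have xh : x ^+ p.-1./2 = 1 by rewrite -quad_charE x1.
have [z] := finField_prim_root 'F_p; rewrite (card_Fp pp) => zP.
have /(prim_rootP zP)[i xi] := Fp_expf _ x0.
move: xh; rewrite xi -exprM => /eqP; rewrite -(prim_order_dvd zP) {1}half_prime -mul2n.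
rewrite dvdn_pmul2r => [/dvdnP[j ->]|]; first by exists (z ^+ j); rewrite exprM.
by have := half_prime; have := odd_prime_gt2 p_odd pp; case: (_./2) => //; lia.
Qed.

Lemma sum_quad_char : \sum_(x : 'F_p) quad_char p x = 0.
Proof.
have [g g0 gN] : exists2 g : 'F_p, g != 0 & quad_char p g = -1.
  have [z] := finField_prim_root 'F_p; rewrite (card_Fp pp) => zP.
  have z0 : z != 0.
    apply/eqP => z0; have /eqP := prim_expr_order zP; rewrite z0 expr0n.
    by rewrite -[_ == 0%N]negbK -lt0n (prim_order_gt0 zP) eq_sym oner_eq0.
  exists z => //; have [] := quad_char_sign z z0 => // z1.
  have : z ^+ p.-1./2 = 1 by rewrite -quad_charE z1.
  move/eqP; rewrite -(prim_order_dvd zP) => /dvdn_leq.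
  by have := half_prime; have := odd_prime_gt2 p_odd pp; lia.
have : \sum_(x : 'F_p) quad_char p x = - \sum_(x : 'F_p) quad_char p x.
  rewrite {1}(reindex_inj (mulfI g0)) -sumrN; apply: eq_bigr => x _.
  by rewrite quad_charM gN mulN1r.
by lia.
Qed.

(** The use of Gauss sums: a square root t of a in a field of characteristic p shows
    the quadratic character of a by the action of the Frobenius map on t. *)
Lemma quad_char_of_sqrt (F : finFieldType) (t : F) (a s : int) : p \in [pchar F] ->
  t != 0 -> t ^+ 2 = a%:~R -> s = 1 \/ s = -1 -> t ^+ p = s%:~R * t ->
  quad_char p a%:~R = s.
Proof.
move=> pF t0 ta s1 ts; apply: (sign_inj F) => //; rewrite ?quad_char_val //.
  by case: s1 => ->.
have as_ : (a%:~R : F) ^+ p.-1./2 = s%:~R.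
  apply: (mulIf t0); rewrite -ts -ta -exprM mul2n -half_prime -exprSr prednK ?prime_gt0 //.
rewrite -as_.
have : (quad_char p a%:~R - a ^+ p.-1./2)%:~R == 0 :> 'F_p.
  by rewrite rmorphB /= quad_charE rmorphXn subrr.
rewrite (intr_eq0_pchar _ _ _ mem_pchar_Fp) -(intr_eq0_pchar _ _ _ pF) rmorphB subr_eq0 rmorphXn.
by move/eqP.
Qed.
End OddPrime.

(** * Quadratic reciprocity *)

Lemma quad_charN1 p : prime p -> odd p -> quad_char p (-1)%:~R = (-1) ^+ p.-1./2.
Proof.
move=> pp po; apply: (sign_inj p pp po 'F_p _ _ (mem_pchar_Fp p pp)); rewrite ?quad_char_val //.
  by rewrite -signr_odd !inE; case: odd.
by rewrite quad_charE // !rmorphXn.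
Qed.

(** For z a primitive 8th root of unity, z + 1/z is a square root of 2, and the
    Frobenius map multiplies it by a sign that depends on q mod 8. *)
Lemma quad_char2 q : prime q -> odd q ->
  quad_char q 2%:~R = if (q %% 8)%N \in [:: 1%N; 7%N] then 1 else -1.
Proof.
move=> qp qo; have q8 : coprime q 8 by rewrite (@coprime_pexpr 3 q 2) ?coprimen2.
have [F [qF [z zP]]] := exists_root_of_unity q 8 qp isT q8.
have z8 := prim_expr_order zP.
have z4 : z ^+ 4 = -1.
  have : z ^+ 4 != 1 by rewrite -(prim_order_dvd zP).
  have : (z ^+ 4) ^+ 2 = 1 by rewrite -exprM.
  by move/eqP; rewrite sqrf_eq1 => /orP[/eqP->|/eqP//]; rewrite eqxx.
have t2 : (z + z ^+ 7) ^+ 2 = 2%:~R.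
  transitivity (z ^+ 8 * (2%:R + z ^+ 4 * z ^+ 2) + z ^+ 2); first by ring.
  by rewrite z8 z4; ring.
have tq : (z + z ^+ 7) ^+ q = z ^+ (q %% 8) + (z ^+ (q %% 8)) ^+ 7.
  rewrite -!(pFrobenius_autE qF) rmorphD rmorphXn /= !pFrobenius_autE.
  by rewrite -!(prim_expr_mod zP q).
apply: (quad_char_of_sqrt q qp qo F (z + z ^+ 7)) => //.
- apply/eqP => t0; have /eqP := t2; rewrite t0 expr0n /= eq_sym.
  by rewrite (intr_eq0_pchar _ _ _ qF) => /dvdn_leq; have := odd_prime_gt2 qo qp; lia.
- by case: ifP; [left | right].
rewrite tq; have : (q %% 8)%N \in [:: 1; 3; 5; 7]%N.
  have : (q %% 8 < 8)%N by rewrite ltn_mod.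
  have : odd (q %% 8) by move: qo; rewrite {1}(divn_eq q 8) oddD oddM andbF.
  by case: (q %% 8)%N => [|[|[|[|[|[|[|[|?]]]]]]]].
rewrite !inE => /or4P[] /eqP -> /=; rewrite ?mulN1r ?mul1r ?mulN1z.
- by [].
- transitivity (z ^+ 3 + z ^+ 4 * z ^+ 8 * z ^+ 8 * z); first by ring.
  rewrite z8 z4; transitivity (- (z ^+ 4 * z ^+ 3 + z)); [by rewrite z4; ring | by ring].
- transitivity (z ^+ 4 * z + z ^+ 8 * z ^+ 8 * z ^+ 8 * z ^+ 8 * z ^+ 3); first by ring.
  rewrite z8 z4; transitivity (- (z ^+ 4 * z ^+ 3 + z)); [by rewrite z4; ring | by ring].
- by transitivity (z ^+ 7 + z ^+ 8 * z ^+ 8 * z ^+ 8 * z ^+ 8 * z ^+ 8 * z ^+ 8 * z); [ring | rewrite z8; ring].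
Qed.

Section GaussSum.
Variables (p q : nat).
Hypotheses (pp : prime p) (p_odd : odd p) (qp : prime q) (q_odd : odd q) (pq : p != q).

(** The Gauss sum t of the quadratic character of F_p, taken in a field of
    characteristic q, is a square root of (-1)^((p-1)/2) p, and the Frobenius map
    multiplies it by the quadratic character of q modulo p. *)
Lemma quadratic_reciprocity :
  quad_char q (((-1) ^+ p.-1./2 * p%:Z)%:~R) = quad_char p q%:R.
Proof.
have cop : coprime q p by rewrite prime_coprime // dvdn_prime2 // eq_sym.
have [F [qF [z zP]]] := exists_root_of_unity q p qp (prime_gt0 pp) cop.
pose e (a : 'F_p) : F := z ^+ (a : nat).
have en n : e n%:R = z ^+ n by rewrite /e val_Fp_nat // (prim_expr_mod zP).
have eD a b : e (a + b) = e a * e b.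
  by rewrite -{1}[a]natr_Zp -{1}[b]natr_Zp -natrD en exprD.
have e0 : e 0 = 1 by rewrite -[0]/(0%:R) en.
have sum_e : \sum_a e a = 0.
  have e1 : e 1 != 1.
    rewrite -[1]/(1%:R) en -(prim_order_dvd zP).
    by apply/negP => /dvdn_leq; have := prime_gt1 pp; lia.
  have : e 1 * \sum_a e a = \sum_a e a.
    by rewrite mulr_sumr [RHS](reindex_inj (addrI 1)); apply: eq_bigr => a _; rewrite eD.
  move/eqP; rewrite -subr_eq0 -{2}[\sum_a _]mul1r -mulrBl mulf_eq0 subr_eq0 (negbTE e1).
  by move/eqP.
have sum_ed d : \sum_(a | a != 0) e (a * d) = (if d == 0 then p%:R else 0) - 1.
  have -> : \sum_(a | a != 0) e (a * d) = \sum_a e (a * d) - 1.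
    by rewrite [in RHS](bigD1 0) //= mul0r e0 addrAC subrr add0r.
  congr (_ - _); case: eqP => [->|/eqP d0].
    by rewrite (eq_bigr (fun=> 1)) => [|a _]; rewrite ?mulr0 // sumr_const card_Fp.
  by rewrite -[RHS]sum_e [RHS](reindex_inj (mulIf d0)).
pose chi (a : 'F_p) : F := (quad_char p a)%:~R.
have chiM a b : chi (a * b) = chi a * chi b by rewrite /chi quad_charM // rmorphM.
have chi0 : chi 0 = 0 by rewrite /chi /quad_char eqxx.
have chi_sq a : a != 0 -> chi a * chi a = 1.
  by move=> a0; rewrite /chi; case: (quad_char_sign p a a0) => ->; rewrite -rmorphM.
have sum_chi : \sum_a chi a = 0 by rewrite -rmorph_sum sum_quad_char.
pose t := \sum_a chi a * e a.
have t2 : t ^+ 2 = ((-1) ^+ p.-1./2 * p%:Z)%:~R.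
  transitivity (\sum_(a | a != 0) \sum_c chi c * e (a * (1 + c))).
    rewrite expr2 {1}/t mulr_suml (bigD1 0) //= chi0 !mul0r add0r.
    apply: eq_bigr => a a0; rewrite mulr_sumr (reindex_inj (mulfI a0)) /=.
    apply: eq_bigr => c _; rewrite chiM mulrDr mulr1 eD.
    transitivity (chi a * chi a * chi c * (e a * e (a * c))); first by ring.
    by rewrite chi_sq // mul1r.
  rewrite exchange_big /=.
  transitivity (\sum_c (chi c * (if c == -1 then p%:R else 0) - chi c)).
    by apply: eq_bigr => c _; rewrite -mulr_sumr sum_ed mulrBr mulr1 (addrC 1) addr_eq0.
  rewrite sumrB sum_chi subr0 (bigD1 (-1)) //= eqxx big1 => [|c /negbTE ->]; last by rewrite mulr0.
  by rewrite addr0 /chi rmorphM /= -quad_charN1.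
have tq : t ^+ q = (quad_char p q%:R)%:~R * t.
  rewrite -(pFrobenius_autE qF) rmorph_sum /= mulr_sumr.
  have q0 : (q%:R : 'F_p) != 0.
    by rewrite -(dvdn_pcharf (mem_pchar_Fp p pp)) dvdn_prime2.
  rewrite [in RHS](reindex_inj (mulfI q0)) /=; apply: eq_bigr => a _.
  rewrite pFrobenius_autE exprMn chiM mulrA -/(chi _) mulrA chi_sq // mul1r; congr (_ * _).
    rewrite /chi; have := quad_char_val p a; rewrite !inE => /or3P[]/eqP ->.
    + by rewrite expr0n; case: (q) qp.
    + by rewrite expr1n.
    + by rewrite mulrN1z -signr_odd q_odd expr1.
  by rewrite -[a in RHS]natr_Zp -natrM en /e -exprM mulnC.
apply: (quad_char_of_sqrt q qp q_odd F t) => //.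
- apply/eqP => t0; have /eqP := t2; rewrite t0 expr0n /= eq_sym.
  rewrite (intr_eq0_pchar _ _ _ qF) dvdzE -signr_odd abszMsign /=.
  by rewrite dvdn_prime2 // eq_sym (negbTE pq).
- by apply: (quad_char_sign p); rewrite -(dvdn_pcharf (mem_pchar_Fp p pp)) dvdn_prime2.
Qed.
End GaussSum.

(** * Classes represented by products of split primes *)

Lemma real_charM {k f g} : real_char k f -> real_char k g -> real_char k (fun n => f n * g n).
Proof.
move=> [fM fP f1 f0] [gM gP g1 g0]; split=> [m n|n|n nk|n nk].
- by rewrite fM gM; ring.
- by rewrite fP gP.
- by case: (f1 n nk) => ->; case: (g1 n nk) => ->; [left | right | right | left].
- by rewrite f0 // mul0r.
Qed.

(** When chi n = (D / n), this says that all the prime factors of m split in the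
    quadratic field of D; in particular m is prime to the modulus of chi. *)
Definition splits (chi : nat -> int) (m : nat) : Prop :=
  (0 < m)%N /\ forall p, prime p -> (p %| m)%N -> chi p = 1.

(** The classes of the numbers m s^2, with m a product of primes of character 1, form
    a group containing the squares. If it missed c, a character f trivial on it
    with f c = -1 would exist; then f and f chi are both nontrivial, and a prime p
    where both are -1 has chi p = 1, so that its class is in the group although
    f p = -1. *)
Lemma real_char_represent (k c : nat) (chi : nat -> int) :
  (1 < k)%N -> real_char k chi -> chi c = 1 ->
  exists m s : nat, [/\ splits chi m, coprime s k & c = m * s ^ 2 %[mod k]].
Proof.
move=> k1 chiR c1; have [cM cP cpm c0] := chiR.
have cop n : chi n != 0 -> coprime n k by case: (boolP (coprime n k)) => // /c0 ->.
pose W n := exists m s : nat, [/\ splits chi m, coprime s k & n = m * s ^ 2 %[mod k]].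
apply: contrapT => cW.
have [|||||f [fR fW fc]] := real_char_separation k c W k1.
- by move=> n; rewrite /W modn_mod.
- move=> n n' _ _ [m [s [[m0 mS] sk nE]]] [m' [s' [[m0' mS'] sk' nE']]].
  exists (m * m')%N, (s * s')%N; split.
  + split=> [|p pp]; first by rewrite muln_gt0 m0.
    by rewrite Euclid_dvdM // => /orP[]; [apply: mS | apply: mS'].
  + by rewrite coprimeMl sk.
  + by rewrite expnMn mulnACA -modnMm nE nE' modnMm.
- move=> n nk; exists 1%N, n; rewrite mul1n; split=> //; split=> // p pp.
  by rewrite dvdn1 => /eqP p1; move: pp; rewrite p1.
- by apply: cop; rewrite c1.
- exact: cW.
have [|p [pp fp fchip]] := prime_both_minus_one k f _ c c (ltnW k1) fR (real_charM fR chiR) fc.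
  by rewrite fc c1.
have chip : chi p = 1 by move: fchip; rewrite fp; lia.
have : f p = 1.
  apply: fW; first by apply: cop; rewrite chip.
  exists p, 1%N; rewrite muln1; split=> //; last exact: coprime1n.
  by split=> [|r rp]; [apply: prime_gt0 | rewrite dvdn_prime2 // => /eqP ->].
by rewrite fp.
Qed.

Lemma inverse_mod (a n : int) : coprimez a n -> exists b, (n %| a * b - 1)%Z.
Proof.
move/coprimezP => [[u v] /= E]; exists u; apply/dvdzP; exists (- v).
by rewrite -[X in _ - X]E; ring.
Qed.

(** Hensel lifting and the Chinese remainder theorem, one prime factor at a time. *)
Lemma sqr_mod_of_primes (D : int) (m : nat) : (0 < m)%N ->
  (forall p, prime p -> (p %| m)%N ->
     [/\ odd p, ~~ (p %| D)%Z & exists x : int, (p %| x ^+ 2 - D)%Z]) ->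
  exists B : int, (m %| B ^+ 2 - D)%Z.
Proof.
elim/ltn_ind: m => m IH m0 mS.
have [->|m1] : m = 1%N \/ (1 < m)%N by lia.
  by exists 0; rewrite dvd1z.
have pp := pdiv_prime m1; have pm := pdiv_dvd m; set p := pdiv m in pp pm.
have [m' mE] : exists m', m = (p * m')%N by case/dvdnP: pm => m' ->; exists m'; rewrite mulnC.
have m'0 : (0 < m')%N by move: m0; rewrite mE muln_gt0 => /andP[].
have [||B' /dvdzP[t tE]] := IH m' _ m'0.
- by rewrite mE ltn_Pmull // prime_gt1.
- by move=> r rp rm; apply: mS => //; rewrite mE dvdn_mull.
have [p_odd pD [x /dvdzP[y yE]]] := mS p pp pm.
(* B' + m' u is a root modulo p m' when p divides t + 2 B' u + m' u^2, where
   B'^2 - D = t m'. If p divides m' this congruence is linear in u; otherwise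
   u is chosen so that B' + m' u = x modulo p. *)
have [u [v uE]] : exists u v : int, t + 2 * B' * u + m'%:Z * u ^+ 2 = v * p%:Z.
  case: (boolP (p %| m')%N) => [/dvdnP[m'' m''E]|pm'].
    have copB : coprimez (2 * B') p.
      rewrite coprimezE /= abszM coprimeMl; apply/andP; split.
        by rewrite prime_coprime // dvdn_prime2 // ; case: eqP p_odd => // <-.
      rewrite coprime_sym prime_coprime //; apply: contra pD => pB.
      have -> : D = B' * B' - t * m'%:Z by rewrite -tE; ring.
      by apply: rpredB; [apply: dvdz_mulr | rewrite m''E PoszM mulrA dvdz_mull].
    have [w /dvdzP[v vE]] := inverse_mod _ _ copB.
    exists (- t * w), (- t * v + m''%:Z * (t * w) ^+ 2); rewrite m''E PoszM.
    transitivity (- t * (2 * B' * w - 1) + m''%:Z * p%:Z * (t * w) ^+ 2); first by ring.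
    by rewrite vE; ring.
  have cop : coprimez m' p by rewrite coprimezE coprime_sym /= prime_coprime.
  have [w /dvdzP[v vE]] := inverse_mod _ _ cop.
  have : (p %| m'%:Z * (t + 2 * B' * (w * (x - B')) + m'%:Z * (w * (x - B')) ^+ 2))%Z.
    have -> : m'%:Z * (t + 2 * B' * (w * (x - B')) + m'%:Z * (w * (x - B')) ^+ 2) =
       (t * m'%:Z + (m'%:Z * w * (x - B')) * (2 * B' + m'%:Z * w * (x - B'))) by ring.
    have -> : m'%:Z * w = v * p + 1 by rewrite -vE; ring.
    apply/dvdzP; exists (y + v * (x - B') * (2 * B' + (v * p + 1) * (x - B')) + (x - B') * v * (x - B')).
    by rewrite -tE !mulrDl -yE; ring.
  by rewrite Gauss_dvdzr 1?coprimez_sym // => /dvdzP[z zE]; exists (w * (x - B')), z.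
exists (B' + m'%:Z * u); apply/dvdzP; exists v; rewrite mE PoszM mulrA -uE.
transitivity ((B' ^+ 2 - D) + (2 * B' * u + m'%:Z * u ^+ 2) * m'%:Z); first by ring.
by rewrite tE; ring.
Qed.

(** * The Jacobi symbol as a periodic function *)

(** For odd n, chi8 a b n is the Jacobi symbol of (-1)^a 2^b over n. *)
Definition chi8 (a b : bool) (n : nat) : int :=
  nth 0 (if a then if b then [:: 0; 1; 0; 1; 0; -1; 0; -1] else [:: 0; 1; 0; -1; 0; 1; 0; -1]
         else if b then [:: 0; 1; 0; -1; 0; -1; 0; 1] else [:: 0; 1; 0; 1; 0; 1; 0; 1]) (n %% 8).

Lemma real_char_chi8 a b : real_char 8 (chi8 a b).
Proof.
split=> [m n|n|n|n].
- rewrite /chi8 -modnMm; move: (m %% 8)%N (ltn_pmod m (isT : 0 < 8)%N) => {}m m8.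
  move: (n %% 8)%N (ltn_pmod n (isT : 0 < 8)%N) => {}n n8.
  by move: m m8 n n8; do 8?[case=> [|]]; move=> // _; do 8?[case=> [|]] => // _; case: a; case: b.
- by rewrite /chi8 modn_mod.
- rewrite /chi8 -coprime_modl; have := ltn_pmod n (isT : 0 < 8)%N.
  case: (n %% 8)%N => [|[|[|[|[|[|[|[|?]]]]]]]] // _ _; case: a; case: b; by [left | right].
- rewrite /chi8 -coprime_modl; have := ltn_pmod n (isT : 0 < 8)%N.
  by case: (n %% 8)%N => [|[|[|[|[|[|[|[|?]]]]]]]] // _ _; case: a; case: b.
Qed.

Lemma chi8_xor a b a' b' n : chi8 (a (+) a') (b (+) b') n = chi8 a b n * chi8 a' b' n.
Proof.
rewrite /chi8; have := ltn_pmod n (isT : 0 < 8)%N.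
case: (n %% 8)%N => [|[|[|[|[|[|[|[|?]]]]]]]] // _; by case: a; case: b; case: a'; case: b'.
Qed.

Lemma sign_half n : odd n -> (-1) ^+ n.-1./2 = chi8 true false n.
Proof.
move=> no; have r8 := ltn_pmod n (isT : 0 < 8)%N.
have nE : n = (8 * (n %/ 8) + n %% 8)%N by rewrite mulnC -divn_eq.
rewrite /chi8 -signr_odd; have -> : odd n.-1./2 = odd ((n %% 8).-1./2) by lia.
have : odd (n %% 8) by lia.
by case: (n %% 8)%N r8 => [|[|[|[|[|[|[|[|?]]]]]]]].
Qed.

Lemma quad_char_1 q : prime q -> odd q -> quad_char q 1 = 1.
Proof. by move=> qp qo; rewrite /quad_char oner_eq0 expr1n eqxx. Qed.

Lemma quad_char_chi8 q (a b : bool) : prime q -> odd q ->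
  quad_char q ((-1) ^+ a * 2 ^+ b)%:~R = chi8 a b q.
Proof.
move=> qp qo; rewrite rmorphM quad_charM //=.
have -> : chi8 a b q = chi8 a false q * chi8 false b q by rewrite -chi8_xor addbF addFb.
have chi8ff : chi8 false false q = 1.
  rewrite /chi8; have : odd (q %% 8) by lia.
  by have := ltn_pmod q (isT : 0 < 8)%N; case: (q %% 8)%N => [|[|[|[|[|[|[|[|?]]]]]]]].
congr (_ * _).
  by case: a; rewrite ?expr1 ?quad_charN1 ?sign_half // expr0 quad_char_1.
case: b; rewrite ?expr0 ?quad_char_1 // expr1 quad_char2 // /chi8.
have : odd (q %% 8) by lia.
by have := ltn_pmod q (isT : 0 < 8)%N; case: (q %% 8)%N => [|[|[|[|[|[|[|[|?]]]]]]]].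
Qed.

(** J is the Jacobi symbol a |-> (a / M), built one prime factor of M at a time. The
    last two properties are reciprocity, with the sign (-1)^((M-1)/2) written as
    chi8 true false M, and the supplementary law for -2. *)
Lemma jacobi_symbol (M : nat) : odd M ->
  exists J : int -> int,
    [/\ forall a b, J (a * b) = J a * J b,
        forall a b, (M %| a - b)%Z -> J a = J b,
        forall a, coprimez a M -> J a = 1 \/ J a = -1
      & forall a, ~~ coprimez a M -> J a = 0] /\
    [/\ forall q, prime q -> odd q -> ~~ (q %| M)%N ->
          quad_char q (chi8 true false M * M%:Z)%:~R = J q%:Z
      & J (-2) = chi8 true true M].
Proof.
elim/ltn_ind: M => M IH M_odd.
have [->|M1] : M = 1%N \/ (1 < M)%N by lia.
  exists (fun=> 1); split; split=> //; first by left.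
    by move=> a; rewrite coprimezE coprimen1.
  by move=> q qp qo _; rewrite mulr1 quad_char_1.
have pp := pdiv_prime M1; have pM := pdiv_dvd M; set p := pdiv M in pp pM.
have [M' ME] : exists M', M = (p * M')%N by case/dvdnP: pM => M' ->; exists M'; rewrite mulnC.
have /andP[po M'o] : odd p && odd M' by move: M_odd; rewrite ME oddM.
have M'0 : (0 < M')%N by case: (M') M'o.
have [|J [[JM Jmod J1 J0] [Jq J2]]] := IH M' _ M'o; first by rewrite ME ltn_Pmull // prime_gt1.
have copE a : coprimez a M = (a%:~R != 0 :> 'F_p) && coprimez a M'.
  rewrite (intr_eq0_pchar _ _ _ (mem_pchar_Fp p pp)) dvdzE /= -prime_coprime // [in RHS]coprime_sym.
  by rewrite !coprimezE ME /= coprimeMr.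
have [chiM _ _ _] := real_char_chi8 true false; have [chiM' _ _ _] := real_char_chi8 true true.
exists (fun a => quad_char p a%:~R * J a); split; [split=> [a b|a b Mab|a|a] | split=> [q qp qo qM|]].
- by rewrite JM rmorphM quad_charM //=; ring.
- congr (quad_char p _ * _); last by apply: Jmod; apply: dvdz_trans Mab; rewrite ME dvdzE /= dvdn_mull.
  apply/eqP; rewrite -subr_eq0 -rmorphB (intr_eq0_pchar _ _ _ (mem_pchar_Fp p pp)).
  by apply: dvdz_trans Mab; rewrite ME dvdzE /= dvdn_mulr.
- rewrite copE => /andP[ap /J1]; case: (quad_char_sign _ _ ap) => ->.
    by case=> ->; [left | right].
  by case=> ->; [right | left].
- rewrite copE negb_and negbK => /orP[/eqP ->|/J0 ->]; rewrite ?mulr0 //.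
  by rewrite /quad_char eqxx mul0r.
- move: qM; rewrite ME Euclid_dvdM // negb_or => /andP[qp' qM'].
  have pq : p != q by apply: contra qp' => /eqP ->.
  rewrite -Jq // -(quadratic_reciprocity p q) // sign_half // -quad_charM // -rmorphM.
  by rewrite chiM PoszM; congr (quad_char q _%:~R); ring.
- by rewrite J2 ME chiM' -(quad_char_chi8 p).
Qed.

(** * The three-square theorem *)

(** For N = 2^b M, the sign a makes (-1)^a 2^b (-1)^((M-1)/2) M equal to -N. So the
    product of chi8 a b and the Jacobi symbol modulo M is the symbol (-N / n) for n
    prime to 2 N: it is periodic by its definition, and by reciprocity its value
    at a prime q decides whether -N is a square modulo q. *)
Lemma kronecker_character (M : nat) (b : bool) : odd M ->
  exists (J : int -> int) (a : bool),
    [/\ (forall x y, J (x * y) = J x * J y) /\ (forall x y, (M %| x - y)%Z -> J x = J y),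
        (forall x, coprimez x M -> J x = 1 \/ J x = -1) /\ J (-2) = chi8 true true M,
        a = (M %% 4 == 1)%N,
        real_char (8 * M) (fun n => chi8 a b n * J n%:Z)
      & forall q, prime q -> chi8 a b q * J q%:Z = 1 ->
          [/\ odd q, ~~ (q %| - (2 ^+ b * M%:Z))%Z &
              exists x : int, (q %| x ^+ 2 - - (2 ^+ b * M%:Z))%Z]].
Proof.
move=> M_odd; have [J [[JM Jmod J1 J0] [Jq J2]]] := jacobi_symbol M M_odd.
exists J, (M %% 4 == 1)%N; set a := (M %% 4 == 1)%N.
have [cM cP c1 c0] := real_char_chi8 a b.
have cop n : coprime n (8 * M) = coprime n 8 && coprimez n M.
  by rewrite coprimeMr coprimezE.
split=> //.
  split=> [m n|n|n|n].
  - by rewrite cM PoszM JM; ring.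
  - rewrite -(cP (n %% _)%N) modn_dvdm ?dvdn_mulr // cP; congr (_ * _); apply: Jmod.
    apply/dvdzP; exists (- (8 * (n %/ (8 * M))%:Z)).
    by rewrite {2}(divn_eq n (8 * M)) PoszD !PoszM; ring.
  - by rewrite cop => /andP[/c1[]-> /J1[]->]; [left | right | right | left].
  - by rewrite cop negb_and => /orP[/c0->|/J0->]; rewrite ?mul0r ?mulr0.
move=> q qp cq.
have q_odd : odd q.
  have : coprime q 8 by case: (boolP (coprime q 8)) cq => // /c0 ->; rewrite mul0r.
  by rewrite (@coprime_pexpr 3 q 2) // coprimen2.
have qM : ~~ (q %| M)%N.
  rewrite -prime_coprime //; case: (boolP (coprime q M)) cq => // qM.
  by rewrite J0 ?mulr0 // coprimezE.
have NE : - (2 ^+ b * M%:Z) = (-1) ^+ a * 2 ^+ b * (chi8 true false M * M%:Z).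
  rewrite /chi8 /a; have : odd (M %% 8) by lia.
  have -> : (M %% 4 = M %% 8 %% 4)%N by rewrite modn_dvdm.
  have := ltn_pmod M (isT : 0 < 8)%N.
  by case: (M %% 8)%N => [|[|[|[|[|[|[|[|?]]]]]]]] //= _ _; ring.
have sq : quad_char q (- (2 ^+ b * M%:Z))%:~R = 1.
  by rewrite NE rmorphM quad_charM //= -/(_%:~R) quad_char_chi8 // Jq.
split=> //.
  rewrite -(intr_eq0_pchar _ _ _ (mem_pchar_Fp q qp)).
  by apply/negP => /eqP q0; move: sq; rewrite q0 /quad_char eqxx.
have [y yE] := quad_char_sqrt q qp q_odd _ sq.
exists (y : nat)%:Z; rewrite -(intr_eq0_pchar _ _ _ (mem_pchar_Fp q qp)) rmorphB rmorphXn /=.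
by rewrite -[(Posz _)%:~R]/(_%:R) natr_Zp yE subrr.
Qed.

Lemma chinese_residue_mod8 (M r : nat) (x : int) : odd M -> exists c : nat,
  (M %| c%:Z - x)%Z /\ (c %% 8 = r %% 8)%N.
Proof.
move=> M_odd; have M0 : (0 < M)%N by case: (M) M_odd.
pose y := `|(x %% M)%Z|%N.
have cop : coprime M 8 by rewrite (@coprime_pexpr 3 M 2) // coprimen2.
exists (chinese M 8 y r); split; last exact: chinese_modr.
have xy : (M %| y%:Z - x)%Z.
  rewrite /y gez0_abs ?modz_ge0 //; last by lia.
  by apply/dvdzP; exists (- (x %/ M)%Z); rewrite {2}(divz_eq x M); ring.
have -> : (chinese M 8 y r)%:Z - x = ((chinese M 8 y r)%:Z - y%:Z) + (y%:Z - x) by ring.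
rewrite rpredD // -eqz_mod_dvd !modz_nat.
by rewrite (chinese_modl cop).
Qed.

(** Adding m to x changes its parity, which can thus be made odd, so that
    y^2 + n is even. *)
Lemma double_modulus (m n : nat) (x : int) : odd m -> odd n ->
  (m %| x ^+ 2 + n%:Z)%Z -> exists y : int, ((2 * m)%N %| y ^+ 2 + n%:Z)%Z.
Proof.
move=> mo no mx.
suff [y y2 my] : exists2 y : int, (2 %| y ^+ 2 + n%:Z)%Z & (m %| y ^+ 2 + n%:Z)%Z.
  exists y; rewrite PoszM Gauss_dvdz ?y2 ?my // coprimezE /= coprime2n //.
have [xo|xe] : (exists k : int, x = 2 * k + 1) \/ (exists k : int, x = 2 * k).
  have := divz_eq x 2; have := modz_ge0 x (isT : 2 != 0 :> int).
  have := @ltz_pmod x 2 isT; move: (x %% 2)%Z (x %/ 2)%Z => r k r2 r0 ->.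
  have [->|->] : r = 0 \/ r = 1 by lia.
    by right; exists k; rewrite addr0 mulrC.
  by left; exists k; rewrite mulrC.
- exists x => //; case: xo => k ->; apply/dvdzP.
  by exists (2 * k ^+ 2 + 2 * k + (n./2)%:Z + 1); rewrite -{1}(odd_double_half n) no; lia.
- exists (x + m%:Z).
    case: xe => k ->; apply/dvdzP.
    exists (2 * k ^+ 2 + 2 * k * m%:Z +
            (2 * (m./2)%:Z ^+ 2 + 2 * (m./2)%:Z + (n./2)%:Z + 1)).
    have mE : m%:Z = 2 * (m./2)%:Z + 1 by lia.
    have nE : n%:Z = 2 * (n./2)%:Z + 1 by lia.
    by rewrite mE nE; ring.
  have -> : (x + m%:Z) ^+ 2 + n%:Z = (x ^+ 2 + n%:Z) + m%:Z * (2 * x + m%:Z) by ring.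
  by rewrite rpredD // dvdz_mulr.
Qed.

(** With N = 2^b M and M odd, a number q = 2^e m is sought where m is a product of
    primes split by (-N / n) whose class modulo squares is that of some c with
    2^e c = -1 modulo M: then -N is a square modulo q and -q is a square modulo N. *)
Theorem three_squares (N : nat) :
  ((N %% 4 == 1) || (N %% 4 == 2) || (N %% 8 == 3))%N ->
  exists x y z : int, N%:Z = x ^+ 2 + y ^+ 2 + z ^+ 2.
Proof.
move=> Nmod.
have [M [b [M_odd NE Mb]]] : exists (M : nat) (b : bool),
    [/\ odd M, N = (2 ^ b * M)%N & [|| b, M %% 4 == 1 | M %% 8 == 3]%N].
  case: (boolP (odd N)) => No; first by exists N, false; rewrite mul1n; split=> //; lia.
  by exists N./2, true; rewrite expn1 orTb; split=> //; lia.
have M0 : (0 < M)%N by case: (M) M_odd.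
have NZ : N%:Z = 2 ^+ b * M%:Z by rewrite NE PoszM; case: (b).
have [J [a [[JM Jmod] [J1 J2] aE chiR chiq]]] := kronecker_character M b M_odd.
rewrite -NZ in chiq.
set chi := (fun n : nat => _) in chiR.
have [_ cP _ _] := real_char_chi8 a b.
have Jm1 : J (-1) = 1 \/ J (-1) = -1 by apply: J1; apply/coprimezP; exists (-1, 0).
(* The inverse of s modulo M is a square root of - 2^e m there; the factors 2 of
   N and of q are dealt with by double_modulus. *)
have glue m s (e : bool) : splits chi m -> coprime s (8 * M) -> ~~ (e && b) ->
    (M %| (2 ^ e * m * s ^ 2)%:Z + 1)%Z ->
    exists x y z : int, N%:Z = x ^+ 2 + y ^+ 2 + z ^+ 2.
  move=> [m0 mS] sk eb Mms.
  have mo : odd m.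
    apply: contraT => me; have m2 : (2 %| m)%N by rewrite dvdn2.
    by have [] := chiq 2%N isT (mS 2%N isT m2).
  have [B mB] : exists B : int, (m %| B ^+ 2 + N%:Z)%Z.
    have [|B] := sqr_mod_of_primes (- N%:Z) m m0; last by rewrite opprK; exists B.
    by move=> p pp pm; apply: chiq => //; apply: mS.
  have [t Mst] : exists t : int, (M %| s%:Z * t - 1)%Z.
    by apply: inverse_mod; rewrite coprimezE; apply: coprime_dvdr sk; rewrite dvdn_mull.
  have Mt : (M %| t ^+ 2 + (2 ^ e * m)%:Z)%Z.
    have -> : t ^+ 2 + (2 ^ e * m)%:Z = t ^+ 2 * ((2 ^ e * m * s ^ 2)%:Z + 1) -
       (2 ^ e * m)%:Z * ((s%:Z * t - 1) * (s%:Z * t + 1)).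
      by rewrite [in RHS]PoszM -[(s ^ 2)%N]/((s * s)%N) PoszM; ring.
    by rewrite rpredB // dvdz_mull // dvdz_mulr.
  have Mm : coprime M m.
    rewrite coprime_sym -[coprime _ _]/(coprimez m M).
    case/dvdzP: Mms => v vE; apply/coprimezP; exists (- (2 ^ e * s ^ 2)%:Z, v).
    rewrite /= -vE !PoszM; ring.
  have [t' Nt] : exists t' : int, (N %| t' ^+ 2 + (2 ^ e * m)%:Z)%Z.
    move: eb Mt; rewrite NE; case: (b); last by rewrite mul1n; exists t.
    rewrite andbT => /negbTE ->; rewrite !mul1n expn1; exact: double_modulus.
  have [B' qB] : exists B' : int, ((2 ^ e * m)%N %| B' ^+ 2 + N%:Z)%Z.
    move: eb mB; case: (e); last by rewrite mul1n; exists B.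
    rewrite andTb NE => /negbTE ->; rewrite mul1n expn1; exact: double_modulus.
  apply: (three_squares_of_mutual_residues N%:Z (2 ^ e * m)%:Z t' B') => //.
  - by rewrite ltz_nat NE muln_gt0 expn_gt0 M0.
  - by rewrite ltz_nat muln_gt0 expn_gt0 m0.
  rewrite coprimezE /= NE.
  move: eb; case: (e); case: (b) => //= _; rewrite ?mul1n ?expn1.
  - by rewrite coprimeMl coprime2n M_odd coprime_sym.
  - by rewrite coprimeMr coprimen2 mo coprime_sym.
  - by rewrite coprime_sym.
have rep c (e : bool) : ~~ (e && b) -> chi c = 1 -> (M %| (2 ^ e * c)%:Z + 1)%Z ->
    exists x y z : int, N%:Z = x ^+ 2 + y ^+ 2 + z ^+ 2.
  move=> eb c1 Mc.
  have [|m [s [mS sk cE]]] := real_char_represent (8 * M) c chi _ chiR c1; first by lia.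
  apply: (glue m s e mS sk eb).
  have -> : (2 ^ e * m * s ^ 2)%:Z + 1 = (2 ^ e * c)%:Z + 1 - (2 ^ e)%:Z * (c%:Z - (m * s ^ 2)%:Z).
    by rewrite !PoszM; ring.
  rewrite rpredB // dvdz_mull // -eqz_mod_dvd !modz_nat.
  by rewrite -(modn_dvdm _ (dvdn_mull 8 (dvdnn M))) cE modn_dvdm ?dvdn_mull.
case: (boolP (b || (M %% 4 == 1)%N)) => [bM | /norP[/negbTE b0 M1]].
  (* As 2^e = 1, the class of c modulo M is that of -1, and the class modulo 8 is
     free: chi8 a b takes both signs, so it can compensate J (-1). *)
  have [r rE] : exists r : nat, chi8 a b r = J (-1).
    rewrite aE; case: Jm1 => ->; first by exists 1%N; case: (_ == _); case: (b).
    by move: bM; case: (b) => [_|/= ->]; [exists 5%N | exists 3%N] => //; case: (_ == _).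
  have [c [cM c8]] := chinese_residue_mod8 M r (-1) M_odd.
  apply: (rep c false) => //; last by rewrite mul1n -[1]opprK.
  by rewrite /chi (Jmod _ _ cM) -cP c8 cP rE; case: Jm1 => ->.
move: Mb; rewrite b0 (negbTE M1) /= => /eqP M3.
(* Here M = 3 modulo 8 and chi8 a b is trivial: with 2 c = -1 modulo M, the value of
   the character at c is J (-2) = 1. *)
have Mc : (2 ^ true * M.-1./2)%:Z + 1 = M%:Z by rewrite expn1; lia.
apply: (rep M.-1./2 true); rewrite ?b0 // ?Mc ?dvdzz //.
have J2c : J (-2) * J (M.-1./2)%:Z = 1.
  have JJ : J 1 = 1.
    have := JM 1 1; rewrite mulr1; have [|->|->] // := J1 1.
    by apply/coprimezP; exists (1, 0).
  rewrite -JM -[RHS]JJ; apply: Jmod; apply/dvdzP; exists (-1); rewrite -Mc expn1 PoszM; ring.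
rewrite /chi aE (negbTE M1) b0.
have -> : J (M.-1./2)%:Z = 1.
  by move: J2c; rewrite J2 /chi8 M3 mul1r.
rewrite mulr1 /chi8.
have : odd (M.-1./2 %% 8) by lia.
have := ltn_pmod M.-1./2 (isT : 0 < 8)%N.
by case: (M.-1./2 %% 8)%N => [|[|[|[|[|[|[|[|?]]]]]]]].
Qed.

(** * The theorem *)

(** In each case a is chosen so that 14 m - 16^a is a square f^2 times some N which
    is 1 or 2 modulo 4 or 3 modulo 8. If 16 divides m, the decomposition found for
    m / 16 is scaled by 4, except that m = 16 and m = 160 are treated directly. *)
Lemma fourteen_mul_sub_pow16 (m : nat) : (1 < m)%N -> m != 10%N ->
  exists (a : nat) (b c d : int), (0 < a)%N /\
    14 * m%:Z = (4 ^+ a) ^+ 2 + b ^+ 2 + c ^+ 2 + d ^+ 2.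
Proof.
elim/ltn_ind: m => m IH m1 m10.
have three a f N : (0 < a)%N -> 14 * m%:Z = (4 ^+ a) ^+ 2 + f ^+ 2 * N%:Z ->
    ((N %% 4 == 1) || (N %% 4 == 2) || (N %% 8 == 3))%N ->
    exists (a : nat) (b c d : int), (0 < a)%N /\
      14 * m%:Z = (4 ^+ a) ^+ 2 + b ^+ 2 + c ^+ 2 + d ^+ 2.
  move=> a0 mE /three_squares[x [y [z Nxyz]]].
  by exists a, (f * x), (f * y), (f * z); split=> //; rewrite mE Nxyz; ring.
have [m_odd|[m' mE]] : odd m \/ exists m', m = (2 * m')%N.
- by case: (boolP (odd m)) => mo; [left | right; exists m./2; lia].
- by apply: (three 1%N 1 (14 * m - 16)%N) => //; lia.
case: (boolP ((m' %% 8 == 1) || (m' %% 8 == 3) || (m' %% 8 == 7) || (m' %% 4 == 2))%N) => m'1.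
  by apply: (three 1%N 2 (7 * m' - 4)%N) => //; lia.
case: (boolP (m' %% 8 == 5)%N) => m'5.
  by apply: (three 2%N 2 (7 * m' - 64)%N) => //; lia.
have [k kE] : exists k, m' = (4 * k)%N by exists (m' %/ 4)%N; lia.
case: (boolP (k %% 4 == 1)%N) => k1.
  by apply: (three 1%N 4 (7 * k - 1)%N) => //; lia.
case: (boolP (k %% 4 == 3)%N) => k3.
  by apply: (three 2%N 4 (7 * k - 16)%N) => //; lia.
have [n nE] : exists n, m = (16 * n)%N by exists (m %/ 16)%N; lia.
have [n1|n1] : n = 1%N \/ (1 < n)%N by lia.
  by apply: (three 1%N 4 13%N) => //; lia.
have [n10|n10] := eqVneq n 10%N.
  by apply: (three 1%N 4 139%N) => //; lia.
have [|a [b [c [d [a0 E]]]]] := IH n _ n1 n10; first by lia.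
exists a.+1, (4 * b), (4 * c), (4 * d); split=> //.
rewrite nE PoszM; transitivity (16 * (14 * n%:Z)); first by ring.
by rewrite E [4 ^+ a.+1]exprS; ring.
Qed.

Theorem theorem1p8 (m : int) (hm : 1 < m) (hm10 : m <> 10) :
  exists x y z w : int,
    m = x ^+ 2 + y ^+ 2 + z ^+ 2 + w ^+ 2 /\
    exists a : nat, (0 < a)%N /\ x + 2 * y + 3 * z = 4 ^+ a.
Proof.
case: m hm hm10 => // m hm hm10.
have [||a [b [c [d [a0 E]]]]] := fourteen_mul_sub_pow16 m.
- exact: hm.
- by apply/eqP => mE; apply: hm10; rewrite mE.
have [x [y [z [w [mE nE]]]]] := four_squares_of_three _ _ _ _ _ E.
by exists x, y, z, w; split=> //; exists a.
Qed.
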